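(* Let $a,b>0$ be constants. There is a randomized algorithm running in time $\tilde O(n^{3.5})$ and a constant $\rho>0$ (depending only on $a,b$) such that on every instance $(G,U,k)$ of Max-Cut-$k$R with $|U|\ge an$ and $k\ge bn$, with high probability it returns $C\subseteq V$ with $|C|=k$ and $\mathrm{cut}(U\triangle C)\ge\rho\cdot\max_{C'\subseteq V,|C'|=k}\mathrm{cut}(U\triangle C')$. (I.e., for $|U|=\Omega(n)$ and $k=\Omega(n)$ there is an $\tilde O(n^{3.5})$-time SDP-based randomized $O(1)$-approximation for Max-Cut-$k$R with high probability.)
   Context: $G=(V,E,w)$ is an undirected graph with non-negative edge weights, $n=|V|$. $\mathrm{cut}(S)$ is the total weight of edges with exactly one endpoint in $S$; $\triangle$ is symmetric difference. Max-Cut-$k$R: given $G$, $U\subseteq V$, $k\in\mathbb{N}$, find $C\subseteq V$ with $|C|=k$ maximizing $\mathrm{cut}(U\triangle C)$. *)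

(* Defs.v *)
From HB Require Import structures.
From mathcomp Require Import all_boot all_order all_algebra.
From mathcomp Require Import boolp classical_sets reals exp.

Set Implicit Arguments.
Unset Strict Implicit.
Unset Printing Implicit Defensive.

Import Order.TTheory GRing.Theory Num.Theory.
Local Open Scope ring_scope.

(* Max-Cut-kR, on the vertex set V = {0, ..., n-1}. *)

Record wgraph (R : realType) (n : nat) := WGraph {
  edge : rel 'I_n;
  weight : 'I_n -> 'I_n -> R;
  edge_sym : symmetric edge;
  edge_irr : irreflexive edge;
  weight_sym : forall u v, edge u v -> weight u v = weight v u;
  weight_ge0 : forall u v, edge u v -> 0 <= weight u v
}.

(* Each edge {u, v} with exactly one endpoint in S contributes exactly once,
   through its orientation with u in S and v outside S. *)
Definition cut (R : realType) (n : nat) (G : wgraph R n) (S : {set 'I_n}) : R :=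
  \sum_(u in S) \sum_(v in ~: S | edge G u v) weight G u v.

Definition symdiff (T : finType) (A B : {set T}) : {set T} :=
  (A :\: B) :|: (B :\: A).

(* The default value 0 of the maximum is harmless: cuts are non-negative. *)
Definition maxcutkR (R : realType) (n : nat) (G : wgraph R n)
    (U : {set 'I_n}) (k : nat) : R :=
  \big[Num.max/0]_(C : {set 'I_n} | #|C| == k) cut G (symdiff U C).

(* Model of computation: a randomized real RAM. Integers live in variables
   ivar and in a random-access memory imem, and are charged logarithmically
   (every integer produced costs its bit length); reals live in variables rvar
   and in a random-access memory rmem, and every arithmetic operation or
   comparison on them costs one unit. There is no conversion from reals to
   integers (no floor). Programs contain no real constants, and their only
   source of randomness is the fair coin flip. *)

Inductive iexp : Type :=
| IVar of nat
| INat of nat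
| IAdd of iexp & iexp
| ISub of iexp & iexp
| IMul of iexp & iexp
| IDiv of iexp & iexp
| ILoad of iexp.

Inductive rexp : Type :=
| RVar of nat
| RInt of iexp
| RAdd of rexp & rexp
| RSub of rexp & rexp
| RMul of rexp & rexp
| RDiv of rexp & rexp
| RLoad of iexp.

Inductive bexp : Type :=
| ILt of iexp & iexp
| RLt of rexp & rexp.

Inductive cmd : Type :=
| Skip
| ISet of nat & iexp
| IStore of iexp & iexp
| RSet of nat & rexp
| RStore of iexp & rexp
| Flip of nat
| Seq of cmd & cmd
| If of bexp & cmd & cmd
| While of bexp & cmd.

Record state (R : realType) := State {
  ivar : nat -> nat;
  imem : nat -> nat;
  rvar : nat -> R;
  rmem : nat -> R
}.

Definition upd (T : Type) (f : nat -> T) (x : nat) (v : T) : nat -> T :=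
  fun y => if y == x then v else f y.

Definition bitlen (m : nat) : nat := (trunc_log 2 m).+1.

(* Subtraction is truncated and division is the Euclidean quotient. *)
Fixpoint ieval (R : realType) (s : state R) (e : iexp) : nat :=
  match e with
  | IVar x => ivar s x
  | INat m => m
  | IAdd e1 e2 => (ieval s e1 + ieval s e2)%N
  | ISub e1 e2 => (ieval s e1 - ieval s e2)%N
  | IMul e1 e2 => (ieval s e1 * ieval s e2)%N
  | IDiv e1 e2 => (ieval s e1 %/ ieval s e2)%N
  | ILoad e1 => imem s (ieval s e1)
  end.

Fixpoint icost (R : realType) (s : state R) (e : iexp) : nat :=
  (bitlen (ieval s e) +
   match e with
   | IVar _ | INat _ => 0
   | IAdd e1 e2 | ISub e1 e2 | IMul e1 e2 | IDiv e1 e2 =>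
       icost s e1 + icost s e2
   | ILoad e1 => icost s e1
   end)%N.

Fixpoint reval (R : realType) (s : state R) (e : rexp) : R :=
  match e with
  | RVar x => rvar s x
  | RInt e1 => (ieval s e1)%:R
  | RAdd e1 e2 => reval s e1 + reval s e2
  | RSub e1 e2 => reval s e1 - reval s e2
  | RMul e1 e2 => reval s e1 * reval s e2
  | RDiv e1 e2 => reval s e1 / reval s e2
  | RLoad e1 => rmem s (ieval s e1)
  end.

Fixpoint rcost (R : realType) (s : state R) (e : rexp) : nat :=
  match e with
  | RVar _ => 1
  | RInt e1 | RLoad e1 => (icost s e1).+1
  | RAdd e1 e2 | RSub e1 e2 | RMul e1 e2 | RDiv e1 e2 =>
      (rcost s e1 + rcost s e2).+1
  end.

Definition beval (R : realType) (s : state R) (e : bexp) : bool :=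
  match e with
  | ILt e1 e2 => (ieval s e1 < ieval s e2)%N
  | RLt e1 e2 => reval s e1 < reval s e2
  end.

Definition bcost (R : realType) (s : state R) (e : bexp) : nat :=
  match e with
  | ILt e1 e2 => (icost s e1 + icost s e2).+1
  | RLt e1 e2 => (rcost s e1 + rcost s e2).+1
  end.

Definition set_ivar (R : realType) (s : state R) (x : nat) (m : nat) : state R :=
  State (upd (ivar s) x m) (imem s) (rvar s) (rmem s).
Definition set_imem (R : realType) (s : state R) (x : nat) (m : nat) : state R :=
  State (ivar s) (upd (imem s) x m) (rvar s) (rmem s).
Definition set_rvar (R : realType) (s : state R) (x : nat) (r : R) : state R :=
  State (ivar s) (imem s) (upd (rvar s) x r) (rmem s).
Definition set_rmem (R : realType) (s : state R) (x : nat) (r : R) : state R :=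
  State (ivar s) (imem s) (rvar s) (upd (rmem s) x r).

(* exec c s w s' w' t: from state s, with w the coin flips to come, the command
   c halts in state s' after t time units, leaving the coin flips w' unused. *)
Inductive exec (R : realType) :
    cmd -> state R -> seq bool -> state R -> seq bool -> nat -> Prop :=
| exec_skip s w : exec Skip s w s w 1
| exec_iset s w x e :
    exec (ISet x e) s w (set_ivar s x (ieval s e)) w (icost s e).+1
| exec_istore s w e1 e2 :
    exec (IStore e1 e2) s w (set_imem s (ieval s e1) (ieval s e2)) w
         (icost s e1 + icost s e2).+1
| exec_rset s w x e :
    exec (RSet x e) s w (set_rvar s x (reval s e)) w (rcost s e).+1
| exec_rstore s w e1 e2 :
    exec (RStore e1 e2) s w (set_rmem s (ieval s e1) (reval s e2)) w
         (icost s e1 + rcost s e2).+1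
| exec_flip s w x (coin : bool) :
    exec (Flip x) s (coin :: w) (set_ivar s x coin) w 1
| exec_seq c1 c2 s1 w1 s2 w2 s3 w3 t1 t2 :
    exec c1 s1 w1 s2 w2 t1 -> exec c2 s2 w2 s3 w3 t2 ->
    exec (Seq c1 c2) s1 w1 s3 w3 (t1 + t2)
| exec_if e c1 c2 s w s' w' t :
    exec (if beval s e then c1 else c2) s w s' w' t ->
    exec (If e c1 c2) s w s' w' (bcost s e + t)
| exec_while_false e c s w :
    beval s e = false -> exec (While e c) s w s w (bcost s e)
| exec_while_true e c s1 w1 s2 w2 s3 w3 t1 t2 :
    beval s1 e = true ->
    exec c s1 w1 s2 w2 t1 -> exec (While e c) s2 w2 s3 w3 t2 ->
    exec (While e c) s1 w1 s3 w3 (bcost s1 e + t1 + t2).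

(* Worst case over the coin flips. A coin flip costs one time unit, so a run of
   at most t time units never needs more than t of them. *)
Definition halts_within (R : realType) (c : cmd) (s : state R) (t : nat) : Prop :=
  forall w : t.-tuple bool,
    exists s' w' t', exec c s w s' w' t' /\ (t' <= t)%N.

(* Probability, over m independent fair coin flips, that c halts in a state
   satisfying Q. *)
Definition prob_halt (R : realType) (c : cmd) (s : state R) (m : nat)
    (Q : state R -> Prop) : R :=
  #|[set w : m.-tuple bool |
       `[< exists s' w' t', exec c s w s' w' t' /\ Q s' >]]|%:R / 2 ^+ m.

(* Input format: n and k in the integer variables 0 and 1, the indicator of U in
   the integer cells 0, ..., n-1, and the weighted adjacency matrix, row by row,
   in the real cells 0, ..., n^2-1; everything else is 0. The sum below has at
   most one term: cell i * n + j holds the weight of ij, or 0 for a non-edge. *)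
Definition input (R : realType) (n : nat) (G : wgraph R n) (U : {set 'I_n})
    (k : nat) : state R :=
  State
    (fun x => nth 0%N [:: n; k] x)
    (fun x => if insub x is Some i then nat_of_bool (i \in U) else 0%N)
    (fun=> 0)
    (fun x => \sum_(i < n) \sum_(j < n | (x == i * n + j)%N && edge G i j)
                 weight G i j).

(* Output format: vertex i belongs to C iff the integer cell n+i is non-zero. *)
Definition output (R : realType) (n : nat) (s : state R) : {set 'I_n} :=
  [set i : 'I_n | imem s (n + i)%N != 0%N].

(* T = O~(f), i.e. T(n) = O(f(n) * (log n)^d) for some constant d. *)
Definition soft_bigO (R : realType) (T : nat -> nat) (f : nat -> R) : Prop :=
  exists (K : R) (d N : nat),
    forall n, (N <= n)%N -> (T n)%:R <= K * f n * ln n%:R ^+ d.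

(* Main.v *)
Require Import Defs.
From HB Require Import structures.
From mathcomp Require Import all_boot all_order all_algebra.
From mathcomp Require Import boolp classical_sets reals exp.
From mathcomp Require Import zify ring lra.

Set Implicit Arguments.
Unset Strict Implicit.
Unset Printing Implicit Defensive.

Import Order.TTheory GRing.Theory Num.Theory.
Local Open Scope ring_scope.

(** A deterministic program achieves the ratio 1/4.
    Since complementing [C] does not change the cut, [|C| = j] with
    [j = min(k, n - k)] may be assumed. Let [gain v] be twice the weight of the
    edges at [v] not cut by [U]: the optimum is at most [cut U + D / 2], where
    [D] is the sum of the [j] largest gains.

    Pair each of these [j] heaviest vertices with one of the others and put
    exactly one vertex of each pair into [C]. In signs [z], four times the cut is
    [sum w (1 - z_u z_v)]; start from [z = 0] on the pairs and fix them one by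
    one, with the sign that does not increase the linear term. The result
    satisfies [4 cut >= 2 cut U + D / 2 + 2 Q], where [Q] sums
    [w_xy s_x s_y] over the pairs, [s] being the signs of [U]. Of two pairings
    without a common pair, one has [2 Q >= - cut U], so [4 cut >= cut U + D / 2]. *)

(** * Loop programs *)

(* [PFor x p] runs [p] for [x = 0, ..., n - 1], where [n] is the value of the
   integer variable 0. *)
Inductive prog : Type :=
| PISet of nat & iexp
| PIStore of iexp & iexp
| PRSet of nat & rexp
| PRStore of iexp & rexp
| PSeq of prog & prog
| PIf of bexp & prog & prog
| PFor of nat & prog.

Definition loop_guard (x : nat) : bexp := ILt (IVar x) (IVar 0).

Definition incr_var (x : nat) : iexp := IAdd (IVar x) (INat 1).

Fixpoint compile (p : prog) : cmd :=
  match p with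
  | PISet x e => ISet x e
  | PIStore e1 e2 => IStore e1 e2
  | PRSet x e => RSet x e
  | PRStore e1 e2 => RStore e1 e2
  | PSeq p q => Seq (compile p) (compile q)
  | PIf b p q => If b (compile p) (compile q)
  | PFor x p => Seq (ISet x (INat 0))
      (While (loop_guard x) (Seq (compile p) (ISet x (incr_var x))))
  end.

Fixpoint run (R : realType) (p : prog) (s : state R) : state R :=
  match p with
  | PISet x e => set_ivar s x (ieval s e)
  | PIStore e1 e2 => set_imem s (ieval s e1) (ieval s e2)
  | PRSet x e => set_rvar s x (reval s e)
  | PRStore e1 e2 => set_rmem s (ieval s e1) (reval s e2)
  | PSeq p q => run q (run p s)
  | PIf b p q => if beval s b then run p s else run q s
  | PFor x p =>
      iter (ivar s 0)
        (fun s1 => let s2 := run p s1 in set_ivar s2 x (ivar s2 x).+1)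
        (set_ivar s x 0)
  end.

Fixpoint writes (x : nat) (p : prog) : bool :=
  match p with
  | PISet y _ => y == x
  | PIStore _ _ | PRSet _ _ | PRStore _ _ => false
  | PSeq p q | PIf _ p q => writes x p || writes x q
  | PFor y p => (y == x) || writes x p
  end.

(** * Integer growth and running time *)

Definition ibounded (R : realType) (s : state R) (M : nat) : Prop :=
  (forall x, (ivar s x <= M)%N) /\ (forall x, (imem s x <= M)%N).

(** A newly stored integer may exceed the current bound by at most one, so integers grow additively
    with the steps executed instead of doubling in length. *)
Definition tame (R : realType) (e : iexp) : Prop :=
  forall (s : state R) M, (1 < M)%N -> ibounded s M -> (ieval s e <= M.+1)%N.

(** These conditions make a compiled loop perform exactly as many iterations as [run] does: variable
    0 is never assigned, and a counter changes only through its own loop. *)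
Fixpoint well_formed (R : realType) (p : prog) : Prop :=
  match p with
  | PISet x e => (0 < x)%N /\ tame R e
  | PIStore e1 e2 => tame R e2
  | PRSet _ _ | PRStore _ _ => True
  | PSeq p q | PIf _ p q => well_formed R p /\ well_formed R q
  | PFor x p => [/\ (0 < x)%N, ~~ writes x p & well_formed R p]
  end.

(** Calibrated so that over integers below [2 ^ L] the value of [e] stays below [2 ^ (L * isize e)]:
    a product adds exponents, a load falls back to [L], and a constant is counted generously. *)
Fixpoint isize (e : iexp) : nat :=
  match e with
  | IVar _ => 1
  | INat m => m.+1
  | IAdd e1 e2 | ISub e1 e2 | IMul e1 e2 | IDiv e1 e2 => (isize e1 + isize e2).+1
  | ILoad e1 => (isize e1).+1
  end.

Fixpoint rsize (e : rexp) : nat :=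
  match e with
  | RVar _ => 1
  | RInt e1 | RLoad e1 => (isize e1 ^ 2).+1
  | RAdd e1 e2 | RSub e1 e2 | RMul e1 e2 | RDiv e1 e2 => (rsize e1 + rsize e2).+1
  end.

Definition bsize (b : bexp) : nat :=
  match b with
  | ILt e1 e2 => (isize e1 ^ 2 + isize e2 ^ 2).+1
  | RLt e1 e2 => (rsize e1 + rsize e2).+1
  end.

(* Bounds both the growth of the integers and, up to the bit length of these
   integers, the running time. *)
Fixpoint prog_weight (p : prog) (n : nat) : nat :=
  match p with
  | PISet _ e => (isize e ^ 2).+1
  | PIStore e1 e2 => (isize e1 ^ 2 + isize e2 ^ 2).+1
  | PRSet _ e => (rsize e).+1
  | PRStore e1 e2 => (isize e1 ^ 2 + rsize e2).+1
  | PSeq p q => prog_weight p n + prog_weight q n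
  | PIf b p q => bsize b + (prog_weight p n + prog_weight q n)
  | PFor x p => n.+1 * (prog_weight p n + 20)
  end.

Fixpoint depth (p : prog) : nat :=
  match p with
  | PISet _ _ | PIStore _ _ | PRSet _ _ | PRStore _ _ => 0
  | PSeq p q | PIf _ p q => maxn (depth p) (depth q)
  | PFor _ p => (depth p).+1
  end.

(** Each nested loop contributes one factor [n.+1]; [prog_weight p 0], where all these factors equal
    1, is the coefficient. *)
Lemma prog_weight_le (p : prog) (n : nat) :
  (prog_weight p n <= prog_weight p 0 * n.+1 ^ depth p)%N.
Proof.
have pw d : (0 < n.+1 ^ d)%N by rewrite expn_gt0.
elim: p => [x e|e1 e2|x e|e1 e2|p IHp q IHq|b p IHp q IHq|x p IHp] /=;
  rewrite ?expn0 ?muln1 //.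
- rewrite mulnDl; apply: leq_add.
    by apply: leq_trans IHp _; rewrite leq_mul2l leq_pexp2l ?leq_maxl ?orbT.
  by apply: leq_trans IHq _; rewrite leq_mul2l leq_pexp2l ?leq_maxr ?orbT.
- rewrite !mulnDl; apply: leq_add; first by rewrite leq_pmulr.
  apply: leq_add.
    by apply: leq_trans IHp _; rewrite leq_mul2l leq_pexp2l ?leq_maxl ?orbT.
  by apply: leq_trans IHq _; rewrite leq_mul2l leq_pexp2l ?leq_maxr ?orbT.
- rewrite mul1n expnS mulnCA leq_mul2l /= mulnDl leq_add // leq_pmulr //.
Qed.

Lemma bitlen_le (m L : nat) : (0 < L)%N -> (m < 2 ^ L)%N -> (bitlen m <= L)%N.
Proof.
move=> L0 mL; rewrite /bitlen.
case: m mL => [|m] mL; first by rewrite trunc_log0.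
by rewrite -(ltn_exp2l _ _ (isT : (1 < 2)%N)) (leq_ltn_trans _ mL) // trunc_logP.
Qed.

Lemma isize_gt0 (e : iexp) : (0 < isize e)%N. Proof. by case: e. Qed.

Section Cost.
Variables (R : realType) (L : nat).

Lemma ieval_lt (s : state R) (M : nat) (e : iexp) :
  ibounded s M -> (M < 2 ^ L)%N -> (0 < L)%N -> (ieval s e < 2 ^ (L * isize e))%N.
Proof.
move=> [sv sm] ML L0.
have mono a b : (a <= b)%N -> (2 ^ (L * a) <= 2 ^ (L * b))%N.
  by move=> ab; rewrite leq_exp2l // leq_mul2l ab orbT.
have p2 e' : (1 < 2 ^ (L * isize e'))%N.
  rewrite -[X in (X < _)%N](expn0 2) ltn_exp2l // muln_gt0 L0 isize_gt0 //.
elim: e => [x|m|e1 H1 e2 H2|e1 H1 e2 H2|e1 H1 e2 H2|e1 H1 e2 H2|e1 H1] /=.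
- by rewrite muln1 (leq_ltn_trans (sv x)).
- rewrite (leq_trans (ltn_expl m (isT : (1 < 2)%N))) // leq_exp2l //; nia.
- have := p2 e1; have := p2 e2; have := mono _ _ (leqnSn (isize e1 + isize e2)).
  by rewrite mulnDr expnD; nia.
- have := mono (isize e1) (isize e1 + isize e2).+1 ltac:(lia); lia.
- have := p2 e1; have := p2 e2; have := mono _ _ (leqnSn (isize e1 + isize e2)).
  by rewrite mulnDr expnD; nia.
- have := mono (isize e1) (isize e1 + isize e2).+1 ltac:(lia).
  have := leq_div (ieval s e1) (ieval s e2); lia.
- have := mono 1%N (isize e1).+1 ltac:(lia); rewrite muln1.
  have := sm (ieval s e1); lia.
Qed.

(** There are at most [isize e] subexpressions, each with a value of at most [L * isize e] bits;
    hence the square. *)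
Lemma icost_le (s : state R) (M : nat) (e : iexp) :
  ibounded s M -> (M < 2 ^ L)%N -> (0 < L)%N -> (icost s e <= isize e ^ 2 * L)%N.
Proof.
move=> sM ML L0.
have B e' : (bitlen (ieval s e') <= L * isize e')%N.
  apply: bitlen_le; [by rewrite muln_gt0 L0 isize_gt0|exact: ieval_lt sM ML L0].
elim: e => [x|m|e1 H1 e2 H2|e1 H1 e2 H2|e1 H1 e2 H2|e1 H1 e2 H2|e1 H1];
  match goal with |- is_true (icost _ ?e <= _)%N => move: (B e) end;
  rewrite /icost -/icost; set b := bitlen _; rewrite /= ?expnS ?expn0; nia.
Qed.

Lemma rcost_le (s : state R) (M : nat) (e : rexp) :
  ibounded s M -> (M < 2 ^ L)%N -> (0 < L)%N -> (rcost s e <= rsize e * L)%N.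
Proof.
move=> sM ML L0.
elim: e => [x|e1|e1 H1 e2 H2|e1 H1 e2 H2|e1 H1 e2 H2|e1 H1 e2 H2|e1] /=;
  rewrite ?mul1n //; try nia;
  by have := icost_le e1 sM ML L0; rewrite mulSn; lia.
Qed.

Lemma bcost_le (s : state R) (M : nat) (b : bexp) :
  ibounded s M -> (M < 2 ^ L)%N -> (0 < L)%N -> (bcost s b <= bsize b * L)%N.
Proof.
move=> sM ML L0; case: b => e1 e2 /=.
- have := icost_le e1 sM ML L0; have := icost_le e2 sM ML L0.
  by rewrite mulSn mulnDl; lia.
- have := rcost_le e1 sM ML L0; have := rcost_le e2 sM ML L0.
  by rewrite mulSn mulnDl; lia.
Qed.

Lemma ivar_run (x : nat) (p : prog) (s : state R) :
  ~~ writes x p -> ivar (run p s) x = ivar s x.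
Proof.
elim: p s => [y e|e1 e2|y e|e1 e2|p IHp q IHq|b p IHp q IHq|y p IHp] s //=.
- by rewrite /upd eq_sym => /negbTE->.
- by move=> /norP[hp hq]; rewrite IHq // IHp.
- by move=> /norP[hp hq]; case: ifP => _; [exact: IHp|exact: IHq].
- move=> /norP[yx hp].
  elim: (ivar s 0) => [|i IHi] /=; rewrite /upd eq_sym (negbTE yx) //.
  by rewrite IHp.
Qed.

Lemma ibounded_incr (s : state R) (M M' : nat) :
  (M <= M')%N -> ibounded s M -> ibounded s M'.
Proof. by move=> MM [h1 h2]; split=> x; apply: leq_trans MM. Qed.

Lemma ibounded_set_ivar (s : state R) (M x m : nat) :
  ibounded s M -> (m <= M)%N -> ibounded (set_ivar s x m) M.
Proof. by move=> [h1 h2] mM; split=> y //=; rewrite /upd; case: ifP. Qed.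

Lemma well_formed_not_writes0 (p : prog) : well_formed R p -> ~~ writes 0 p.
Proof.
elim: p => [y e|e1 e2|y e|e1 e2|p IHp q IHq|b p IHp q IHq|y p IHp] //=.
- by case; case: y.
- by case=> /IHp hp /IHq hq; apply/norP.
- by case=> /IHp hp /IHq hq; apply/norP.
- by case=> y0 _ /IHp hp; rewrite negb_or hp andbT -lt0n.
Qed.

(** Time and integer growth are proved in one induction, since charging a command requires its
    operands to fit in [L] bits in every intermediate state. The single [L] is large enough for the
    bound at the end of the whole run. *)
Lemma exec_compile (p : prog) (s : state R) (w : seq bool) (M n : nat) :
  well_formed R p -> ibounded s M -> ivar s 0 = n -> (1 < M)%N -> (0 < L)%N ->
  (M + prog_weight p n < 2 ^ L)%N ->
  (exists t, exec (compile p) s w (run p s) w t /\ (t <= prog_weight p n * L)%N)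
  /\ ibounded (run p s) (M + prog_weight p n).
Proof.
move=> + + + + L0.
elim: p s M => [y e|e1 e2|y e|e1 e2|p IHp q IHq|b p IHp q IHq|y p IHp] s M
  wf sM sn M1 ML; rewrite /= in wf ML *.
- case: wf => y0 te; have := te s M M1 sM => es.
  split; last first.
    by apply: ibounded_set_ivar; [apply: ibounded_incr sM; lia|lia].
  eexists; split; first exact: exec_iset.
  by have := @icost_le s M e sM ltac:(lia) L0; rewrite mulSn; lia.
- have es := wf s M M1 sM; split; last first.
    case: (@ibounded_incr s M (M + (isize e1 ^ 2 + isize e2 ^ 2).+1) ltac:(lia) sM) => h1 h2.
    by split=> x //=; rewrite /upd; case: ifP => // _; lia.
  eexists; split; first exact: exec_istore.
  have := @icost_le s M e1 sM ltac:(lia) L0.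
  by have := @icost_le s M e2 sM ltac:(lia) L0; rewrite mulSn mulnDl; lia.
- split; last by apply: (@ibounded_incr _ M) => //; lia.
  eexists; split; first exact: exec_rset.
  by have := @rcost_le s M e sM ltac:(lia) L0; rewrite mulSn; lia.
- split; last by apply: (@ibounded_incr _ M) => //; lia.
  eexists; split; first exact: exec_rstore.
  have := @icost_le s M e1 sM ltac:(lia) L0.
  by have := @rcost_le s M e2 sM ltac:(lia) L0; rewrite mulSn mulnDl; lia.
- case: wf => wp wq.
  have [[t1 [ex1 le1]] b1] := IHp s M wp sM sn M1 ltac:(lia).
  have sn1 : ivar (run p s) 0 = n by rewrite ivar_run // well_formed_not_writes0.
  have [[t2 [ex2 le2]] b2] := IHq _ _ wq b1 sn1 ltac:(lia) ltac:(lia).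
  rewrite addnA; split=> //; exists (t1 + t2)%N; split; first exact: exec_seq ex1 ex2.
  by rewrite mulnDl leq_add.
- case: wf => wp wq.
  have bc := @bcost_le s M b sM ltac:(lia) L0.
  have [[t1 [ex1 le1]] b1] := IHp s M wp sM sn M1 ltac:(lia).
  have [[t2 [ex2 le2]] b2] := IHq s M wq sM sn M1 ltac:(lia).
  split; last first.
    by case: ifP => _; [apply: ibounded_incr b1|apply: ibounded_incr b2]; lia.
  exists (bcost s b + (if beval s b then t1 else t2))%N; split.
    by apply: exec_if; case: ifP.
  by rewrite !mulnDl; case: ifP => _; lia.
- case: wf => y0 wy wp.
  have w0 := well_formed_not_writes0 wp.
  set step := (fun s2 : state R => set_ivar (run p s2) y (ivar (run p s2) y).+1).
  set W := prog_weight p n in ML *.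
  set s0 := set_ivar s y 0.
  have s0b : ibounded s0 M by exact: ibounded_set_ivar.
  have key m : (m <= n)%N ->
      [/\ ivar (iter m step s0) y = m, ivar (iter m step s0) 0 = n &
      ibounded (iter m step s0) (M + m * (W + 20))].
    elim: m => [|m IHm] mn; first by rewrite /= /upd eqxx ltn_eqF // mul0n addn0.
    have [i1 i2 i3] := IHm (ltnW mn).
    have i4 : (M + m * (W + 20) + W < 2 ^ L)%N by nia.
    have [_ b1] := IHp _ _ wp i3 i2 ltac:(lia) i4.
    rewrite iterS /step /= /upd eqxx (ltn_eqF y0) !ivar_run // i1 i2; split=> //.
    apply: ibounded_set_ivar; first by apply: ibounded_incr b1; nia.
    nia.
  split; last first.
    have [_ _] := key n (leqnn n); rewrite sn; apply: ibounded_incr; nia.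
  (* Induction on the number [r] of remaining iterations, as a [While] derivation is built from its
     end. An iteration pays 3 for the guard and 17 for the increment of the counter, whence the 20;
     the leading 3 is the failing last test. *)
  have loop r : (r <= n)%N -> exists t,
      exec (While (loop_guard y) (Seq (compile p) (ISet y (incr_var y))))
        (iter (n - r) step s0) w (iter n step s0) w t /\
      (t <= (3 + r * (W + 20)) * L)%N.
    elim: r => [|r IHr] rn.
      rewrite subn0; have [i1 i2 i3] := key n (leqnn n); eexists; split.
        by apply: exec_while_false; rewrite /= i1 i2 ltnn.
      have i4 : (M + n * (W + 20) < 2 ^ L)%N by rewrite mulSn in ML; lia.
      by rewrite mul0n addn0; exact: (bcost_le (loop_guard y) i3 i4 L0).
    have [t2 [ex2 le2]] := IHr (ltnW rn).
    have [i1 i2 i3] := key (n - r.+1)%N (leq_subr _ _).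
    have i4 : (M + (n - r.+1) * (W + 20) + W < 2 ^ L)%N by nia.
    have [[t1 [ex1 le1]] b1] := IHp _ _ wp i3 i2 (leq_trans M1 (leq_addr _ _)) i4.
    have gc := bcost_le (loop_guard y) i3 (leq_ltn_trans (leq_addr _ _) i4) L0.
    have ic := icost_le (incr_var y) b1 i4 L0.
    rewrite /= ?expnS ?expn0 in gc ic.
    eexists; split.
      apply: exec_while_true; first by rewrite /= i1 i2; lia.
        by apply: exec_seq; [exact: ex1|exact: exec_iset].
      have -> : set_ivar (run p (iter (n - r.+1) step s0)) y
          (ieval (run p (iter (n - r.+1) step s0)) (incr_var y)) = iter (n - r) step s0.
        by rewrite (_ : (n - r = (n - r.+1).+1)%N) ?iterS /step /= ?addn1 //; lia.
      exact: ex2.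
    by rewrite /= -/W in le1 *; nia.
  have [t [ex le]] := loop n (leqnn n); rewrite subnn in ex.
  eexists; split; first by rewrite sn; apply: exec_seq; [exact: exec_iset|exact: ex].
  by rewrite /= /bitlen trunc_log0; nia.
Qed.
End Cost.

(* The integers stay below [2 ^ (2 * n + O(1))], so that an integer operation
   costs [O(n)], and the program performs [O(n ^ 2)] of them. *)
Lemma soft_bigO_depth2 (R : realType) (p : prog) :
  well_formed R p -> (depth p <= 2)%N ->
  exists T : nat -> nat, soft_bigO T (fun n : nat => (n%:R : R) `^ (7 / 2)) /\
    forall (s : state R) (n : nat), ivar s 0 = n -> ibounded s (n + 2) ->
    forall w, exists t, exec (compile p) s w (run p s) w t /\ (t <= T n)%N.
Proof.
move=> wf dp; set K := prog_weight p 0.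
have wK n : (prog_weight p n <= K * n.+1 ^ 2)%N.
  by apply: leq_trans (prog_weight_le p n) _; rewrite leq_mul2l leq_pexp2l ?orbT.
(* Weight times bit length. Since [n.+1 ^ 2 <= 2 ^ (2 * n)] and [K + 3 < 2 ^ (K + 3)], integers fit
   in [2 * n + K + 3] bits. *)
exists (fun n => K * n.+1 ^ 2 * (2 * n + K + 3))%N; split; last first.
  move=> s n sn sb w.
  set L := (2 * n + K + 3)%N.
  have nL : (n + 2 + prog_weight p n < 2 ^ L)%N.
    have := wK n; have n1 : (n.+1 <= 2 ^ n)%N by apply: ltn_expl.
    have K1 : (K + 3 < 2 ^ (K + 3))%N by apply: ltn_expl.
    have : (n.+1 ^ 2 <= 2 ^ (2 * n))%N by rewrite mulnC expnM leq_sqr.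
    rewrite /L -(addnA (2 * n)%N) (expnD 2 (2 * n)) => n2 W.
    have : ((K + 3) * n.+1 ^ 2 < 2 ^ (2 * n) * 2 ^ (K + 3))%N.
      by rewrite mulnC; apply: leq_ltn_trans (leq_mul n2 (leqnn _)) _; rewrite ltn_mul2l expn_gt0.
    have : (n + 2 <= 3 * n.+1 ^ 2)%N by rewrite !expnS expn0; nia.
    rewrite mulnDl => h3 h4; apply: leq_ltn_trans h4.
    by rewrite addnC leq_add.
  have [[t [ex le]] _] := @exec_compile R L p s w (n + 2) n wf sb sn ltac:(lia) ltac:(rewrite /L; lia) nL.
  by exists t; split=> //; apply: leq_trans le _; rewrite leq_mul2r wK orbT.
(* The time is cubic, hence below the exponent 7/2 without a logarithmic factor. *)
exists (4 * K * (K + 5))%:R, 0%N, 1%N => n n1.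
rewrite expr0 mulr1.
have h : (K * n.+1 ^ 2 * (2 * n + K + 3) <= 4 * K * (K + 5) * n ^ 3)%N.
  have : (n.+1 ^ 2 <= 4 * n ^ 2)%N by rewrite !expnS !expn0; nia.
  have : (2 * n + K + 3 <= (K + 5) * n)%N by nia.
  move=> h1 h2; apply: leq_trans (leq_mul (leq_mul (leqnn K) h2) h1) _.
  by rewrite !expnS !expn0; lia.
apply: (@le_trans _ _ ((4 * K * (K + 5) * n ^ 3)%:R)); first by rewrite ler_nat.
rewrite natrM ler_wpM2l ?ler0n // natrX -powR_mulrn ?ler0n //.
by apply: ler_powR; rewrite ?ler1n //; lra.
Qed.

(** * Success probability of a deterministic run, and the loop rule *)

(** The run leaves all coins unread and ends in the same state for each of the [2 ^ m] flip
    sequences, so all of them count. *)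
Lemma prob_halt_eq1 (R : realType) (c : cmd) (s s' : state R) (m : nat)
    (Q : state R -> Prop) :
  (forall w, exists t, exec c s w s' w t) -> Q s' -> prob_halt c s m Q = 1.
Proof.
move=> ex Qs; rewrite /prob_halt (_ : [set w | _]%SET = [set: m.-tuple bool]%SET).
  by rewrite cardsT card_tuple card_bool natrX divff // expf_neq0 ?pnatr_eq0.
apply/setP => w; rewrite !inE; apply/asboolP.
by have [t et] := ex w; exists s', w, t.
Qed.

(** The loop rule. The invariant is stated after the counter has been advanced, matching the states
    through which [run] iterates. *)
Lemma for_ind (R : realType) (x : nat) (p : prog) (s : state R) (n : nat)
    (I : nat -> state R -> Prop) :
  (0 < x)%N -> ~~ writes x p -> ~~ writes 0 p -> ivar s 0 = n ->
  I 0 (set_ivar s x 0) ->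
  (forall i s1, (i < n)%N -> ivar s1 x = i -> ivar s1 0 = n ->
     I i s1 -> I i.+1 (set_ivar (run p s1) x i.+1)) ->
  I n (run (PFor x p) s).
Proof.
move=> x0 wx w0 sn I0 IS.
set step := (fun s2 : state R => set_ivar (run p s2) x (ivar (run p s2) x).+1).
suff H m : (m <= n)%N ->
    [/\ I m (iter m step (set_ivar s x 0)),
        ivar (iter m step (set_ivar s x 0)) x = m &
        ivar (iter m step (set_ivar s x 0)) 0 = n].
  by have [] := H n (leqnn n); rewrite /= sn.
elim: m => [|m IHm] mn; first by rewrite /= /upd eqxx ltn_eqF.
have [i1 i2 i3] := IHm (ltnW mn).
rewrite iterS /step; set s1 := iter m _ _ in i1 i2 i3 *.
rewrite ivar_run // i2 /= /upd eqxx ltn_eqF // ivar_run //; split=> //.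
exact: IS.
Qed.

(** * Cuts as quadratic forms *)

Definition wt (R : realType) (n : nat) (G : wgraph R n) (u v : 'I_n) : R :=
  if edge G u v then weight G u v else 0.

(** With -1 marking membership, symmetric difference becomes multiplication, and [1 - sgn u * sgn v]
    is 2 on separated pairs and 0 elsewhere. *)
Definition sgn (R : realType) (T : finType) (A : {set T}) (v : T) : R :=
  if v \in A then -1 else 1.

Definition quad (R : realType) (T : finType) (w : T -> T -> R) (z : T -> R) : R :=
  \sum_u \sum_v w u v * (z u * z v).

Lemma wt_sym (R : realType) (n : nat) (G : wgraph R n) (u v : 'I_n) :
  wt G u v = wt G v u.
Proof. by rewrite /wt edge_sym; case: ifP => // /weight_sym->. Qed.

Lemma wt_ge0 (R : realType) (n : nat) (G : wgraph R n) (u v : 'I_n) :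
  0 <= wt G u v.
Proof. by rewrite /wt; case: ifP => // /weight_ge0. Qed.

Lemma wt_diag (R : realType) (n : nat) (G : wgraph R n) (u : 'I_n) :
  wt G u u = 0.
Proof. by rewrite /wt edge_irr. Qed.

Lemma sgn_cases (R : realType) (T : finType) (A : {set T}) (v : T) :
  sgn R A v = 1 \/ sgn R A v = -1.
Proof. by rewrite /sgn; case: ifP; [right|left]. Qed.

Lemma sgn_symdiff (R : realType) (T : finType) (A B : {set T}) (v : T) :
  sgn R (symdiff A B) v = sgn R A v * sgn R B v.
Proof.
rewrite /sgn /symdiff !inE.
by case: (v \in A); case: (v \in B) => //=; rewrite ?mulrNN ?mulr1 ?mul1r.
Qed.

(** The factor 4: a cut edge occurs in both orientations, each time with the coefficient 2. *)
Lemma cut_sgn (R : realType) (n : nat) (G : wgraph R n) (S : {set 'I_n}) :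
  4 * cut G S = \sum_u \sum_v wt G u v * (1 - sgn R S u * sgn R S v).
Proof.
pose c (u v : 'I_n) : R := ((u \in S) && (v \notin S))%:R * wt G u v.
have cutE : cut G S = \sum_u \sum_v c u v.
  rewrite /cut big_mkcond /=; apply: eq_bigr => u _.
  case: ifP => uS; last by rewrite big1 // => v _; rewrite /c uS mul0r.
  rewrite big_mkcond /=; apply: eq_bigr => v _.
  by rewrite /c uS /wt inE; case: (v \in S); case: edge; rewrite /= ?mul0r ?mul1r ?mulr0.
have -> : \sum_u \sum_v wt G u v * (1 - sgn R S u * sgn R S v) =
          \sum_u \sum_v (2 * c u v + 2 * c v u).
  apply: eq_bigr => u _; apply: eq_bigr => v _.
  rewrite /c /sgn (wt_sym G v u).
  by case: (u \in S); case: (v \in S) => /=; ring.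
under eq_bigr do rewrite big_split /=.
rewrite big_split /= [X in _ = _ + X]exchange_big /=.
under eq_bigr do rewrite -mulr_sumr.
by rewrite -mulr_sumr -cutE; ring.
Qed.

Lemma cut_quad (R : realType) (n : nat) (G : wgraph R n) (S : {set 'I_n}) :
  4 * cut G S = \sum_u \sum_v wt G u v - quad (wt G) (sgn R S).
Proof.
rewrite cut_sgn /quad -sumrB; apply: eq_bigr => u _.
by rewrite -sumrB; apply: eq_bigr => v _; ring.
Qed.

Lemma cut_setC (R : realType) (n : nat) (G : wgraph R n) (S : {set 'I_n}) :
  cut G (~: S) = cut G S.
Proof.
have : 4 * cut G (~: S) = 4 * cut G S.
  rewrite !cut_sgn; apply: eq_bigr => u _; apply: eq_bigr => v _.
  by rewrite /sgn !inE; case: (u \in S); case: (v \in S) => /=; ring.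
by move/(mulfI _); apply; rewrite pnatr_eq0.
Qed.

Lemma symdiff_setC (T : finType) (A B : {set T}) :
  symdiff A (~: B) = ~: symdiff A B.
Proof. by apply/setP => v; rewrite !inE; case: (v \in A); case: (v \in B). Qed.

Lemma cut_ge0 (R : realType) (n : nat) (G : wgraph R n) (S : {set 'I_n}) :
  0 <= cut G S.
Proof. by apply: sumr_ge0 => u _; apply: sumr_ge0 => v /andP[_ /weight_ge0]. Qed.

(* Twice the weight of the edges at [v] that [U] does not cut. *)
Definition gain (R : realType) (n : nat) (G : wgraph R n) (U : {set 'I_n})
    (v : 'I_n) : R :=
  \sum_u wt G v u * (1 + sgn R U v * sgn R U u).

(** The comparison is made pair by pair. A pair cut only after flipping [C] is uncut by [U] and has
    an endpoint in [C], whose gain pays for it. *)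
Lemma cut_symdiff_le (R : realType) (n : nat) (G : wgraph R n)
    (U C : {set 'I_n}) :
  4 * cut G (symdiff U C) <= 4 * cut G U + 2 * \sum_(v in C) gain G U v.
Proof.
pose g (u v : 'I_n) : R := (u \in C)%:R * (wt G u v * (1 + sgn R U u * sgn R U v)).
have gE : \sum_(v in C) gain G U v = \sum_u \sum_v g u v.
  rewrite big_mkcond /=; apply: eq_bigr => u _; rewrite -mulr_sumr.
  by case: ifP; rewrite ?mul1r ?mul0r.
(* Doubling the gains and transposing one copy lets an ordered pair be charged to either
   endpoint. *)
rewrite gE (mulr_natl _ 2) mulr2n.
rewrite [X in _ <= _ + (_ + X)]exchange_big /= !cut_sgn -!big_split /=.
apply: ler_sum => u _; rewrite -!big_split /=; apply: ler_sum => v _.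
rewrite !sgn_symdiff /g (wt_sym G v u).
have := wt_ge0 G u v.
have [-> | ->] := sgn_cases R U u; have [-> | ->] := sgn_cases R U v;
rewrite /sgn; case: (u \in C); case: (v \in C) => /=; nra.
Qed.

(** Exchange argument: without the common part, [C] and [L] leave sets of equal size, and the
    largest value of [f] on the first is at most each value on the second. *)
Lemma sum_top (R : realType) (T : finType) (f : T -> R) (L C : {set T}) :
  #|C| = #|L| -> (forall u v, u \in L -> v \notin L -> f v <= f u) ->
  \sum_(v in C) f v <= \sum_(v in L) f v.
Proof.
move=> CL top.
have cD : #|C :\: L| = #|L :\: C|.
  apply/eqP; rewrite -(eqn_add2l #|C :&: L|) cardsID.
  by rewrite finset.setIC cardsID CL.
rewrite (big_setID L) /= [leRHS](big_setID C) /= finset.setIC lerD2l.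
have [C0|[v0 v0C]] := set_0Vmem (C :\: L).
  move: cD; rewrite C0 cards0 => /esym/eqP; rewrite cards_eq0 => /eqP->.
  by rewrite !big_set0.
pose v1 := [arg max_(v > v0 in C :\: L) f v]%O.
have v1P : v1 \in C :\: L /\ forall v, v \in C :\: L -> f v <= f v1.
  by rewrite /v1; case: Order.TotalTheory.arg_maxP => // v vC h; split.
apply: (@le_trans _ _ (\sum_(v in C :\: L) f v1)); first exact: ler_sum v1P.2.
rewrite sumr_const cD -sumr_const; apply: ler_sum => v.
rewrite inE => /andP[_ vL]; apply: top => //.
by case: v1P => + _; rewrite inE => /andP[].
Qed.

(** * Greedy orientation of a family of disjoint pairs *)

Section Greedy.
Variables (R : realType) (T : finType) (w : T -> T -> R) (s : T -> R).
Hypothesis w_sym : forall u v, w u v = w v u.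
Hypothesis w_diag : forall u, w u u = 0.
Hypothesis s_cases : forall v, s v = 1 \/ s v = -1.
Variables (j : nat) (e : 'I_j -> bool -> T).
Hypothesis e_inj : forall i b i' b', e i b = e i' b' -> i = i' /\ b = b'.

Lemma quad_addZ (z d : T -> R) (t : R) :
  quad w (fun v => z v + t * d v) =
  quad w z + 2 * t * (\sum_u d u * \sum_v w u v * z v) + t ^+ 2 * quad w d.
Proof.
have -> : 2 * t * (\sum_u d u * \sum_v w u v * z v) =
    \sum_u \sum_v w u v * (z u * (t * d v)) + \sum_u \sum_v w u v * (t * d u * z v).
  rewrite [X in _ = X + _]exchange_big /= -big_split /= mulr_sumr.
  apply: eq_bigr => u _; rewrite -big_split /= mulrA mulr_sumr.
  by apply: eq_bigr => v _; rewrite (w_sym v u); ring.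
rewrite /quad mulr_sumr -!big_split /=; apply: eq_bigr => u _.
rewrite mulr_sumr -!big_split /=; apply: eq_bigr => v _.
by ring.
Qed.

Definition unpaired (v : T) : R :=
  if [exists i, exists b, e i b == v] then 0 else s v.

Definition pair_weight (i : 'I_j) : R :=
  w (e i false) (e i true) * (s (e i false) * s (e i true)).

(** For [t = 1] the [false] vertex is flipped against [s] and the [true] one keeps its sign;
    [t = -1] is the reverse. Either way exactly one of the two enters the flipped set. *)
Definition flip_pair (i : 'I_j) (t : R) (z : T -> R) (v : T) : R :=
  if v == e i false then - (t * s v) else if v == e i true then t * s v else z v.

(** Half the derivative of [quad w] at [z] in the direction in which [flip_pair i] moves for
    [t = 1]. *)
Definition pull (i : 'I_j) (z : T -> R) : R :=
  \sum_v z v * (w (e i true) v * s (e i true) - w (e i false) v * s (e i false)).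

(** The state after the first [m] pairs are fixed: later pairs are still 0, and each fixed pair has
    changed the quadratic form by at most minus twice its pair weight. *)
Definition greedy_inv (m : nat) (z : T -> R) : Prop :=
  [/\ forall v, (forall i b, e i b != v) -> z v = s v,
      forall (i : 'I_j) b, (m <= i)%N -> z (e i b) = 0,
      forall i : 'I_j, (i < m)%N -> exists t, [/\ t = 1 \/ t = -1,
        z (e i false) = - (t * s (e i false)) & z (e i true) = t * s (e i true)] &
      quad w z <= quad w unpaired - 2 * \sum_(i < j | (i < m)%N) pair_weight i].

Lemma e_neq i : e i false != e i true.
Proof. by apply/eqP => /e_inj[]. Qed.

(** The move is [t * d] with [d] supported on the pair, with opposite signs relative to [s]. As [w]
    has no diagonal, [quad w d] is minus twice the pair weight, and [t ^+ 2 = 1]. *)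
Lemma quad_flip_pair (i : 'I_j) (t : R) (z : T -> R) :
  t = 1 \/ t = -1 -> (forall b, z (e i b) = 0) ->
  quad w (flip_pair i t z) = quad w z + 2 * t * pull i z - 2 * pair_weight i.
Proof.
move=> tc z0.
pose d v := (v == e i true)%:R * s v - (v == e i false)%:R * s v.
have dsum f : \sum_v d v * f v = s (e i true) * f (e i true) - s (e i false) * f (e i false).
  have one x : \sum_v (v == x)%:R * (s v * f v) = s x * f x.
    rewrite (bigD1 x) //= eqxx mul1r big1 ?addr0 // => v /negbTE->.
    by rewrite mul0r.
  rewrite -(one (e i true)) -(one (e i false)) -sumrB.
  by apply: eq_bigr => v _; rewrite /d; ring.
have -> : flip_pair i t z = (fun v => z v + t * d v).
  apply/funext => v; rewrite /flip_pair /d.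
  case: eqVneq => [->|vx]; first by rewrite z0 (negbTE (e_neq i)) /= mulr0n mulr1n; ring.
  by case: eqVneq => [->|vy]; rewrite ?z0 /= ?mulr0n ?mulr1n; ring.
rewrite quad_addZ dsum.
have -> : quad w d = - 2 * pair_weight i.
  rewrite /quad.
  under eq_bigr => u _.
    rewrite (_ : \sum_v _ = d u * (\sum_v d v * w u v)); last first.
      by rewrite mulr_sumr; apply: eq_bigr => v _; ring.
    rewrite dsum; over.
  by rewrite dsum !w_diag (w_sym (e i true)) /pair_weight; ring.
have -> : pull i z = s (e i true) * (\sum_v w (e i true) v * z v) -
                     s (e i false) * (\sum_v w (e i false) v * z v).
  rewrite !mulr_sumr -sumrB; apply: eq_bigr => v _; ring.
by case: tc => ->; ring.
Qed.

Lemma greedy_init (z : T -> R) : z =1 unpaired -> greedy_inv 0 z.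
Proof.
move=> zE; split=> [v nv|i b _|i //|].
- rewrite zE /unpaired ifF //; apply/negbTE/existsPn => i; apply/existsPn => b.
  exact: nv.
- by rewrite zE /unpaired ifT //; apply/existsP; exists i; apply/existsP; exists b.
- rewrite big1 ?mulr0 ?subr0 // (_ : z = unpaired) //; exact/funext.
Qed.

Lemma greedy_step (i : 'I_j) (z : T -> R) (t : R) :
  greedy_inv i z -> t = 1 \/ t = -1 -> t * pull i z <= 0 ->
  greedy_inv i.+1 (flip_pair i t z).
Proof.
move=> [h1 h2 h3 h4] tc tp.
have other i' b : i' != i -> flip_pair i t z (e i' b) = z (e i' b).
  move=> ii'; rewrite /flip_pair.
  case: eqP => [/e_inj[/eqP]|_]; first by rewrite (negbTE ii').
  by case: eqP => [/e_inj[/eqP]|_] //; rewrite (negbTE ii').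
split.
- move=> v nv; rewrite /flip_pair eq_sym (negbTE (nv i false)).
  by rewrite eq_sym (negbTE (nv i true)) h1.
- move=> i' b ii'; rewrite other ?h2 1?ltnW //.
  by apply: contraTneq ii' => ->; rewrite ltnn.
- move=> i'; rewrite ltnS leq_eqVlt; case: (eqVneq i' i) => [->|ne].
    move=> _; exists t; split=> //; rewrite /flip_pair.
      by rewrite eqxx.
    by rewrite eq_sym (negbTE (e_neq i)) eqxx.
  case/orP => [/eqP/val_inj/eqP|lt]; first by rewrite (negbTE ne).
  by have [t' [t1 t2 t3]] := h3 i' lt; exists t'; rewrite !other.
- rewrite quad_flip_pair //; last by move=> b; apply: h2.
  rewrite (bigD1 i) //=.
  rewrite (eq_bigl (fun i' : 'I_j => (i' < i)%N)); last first.
    move=> i'; rewrite ltnS [(i' <= i)%N]leq_eqVlt andb_orl.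
    by rewrite -(inj_eq val_inj) /=; case: ltngtP.
  by nra.
Qed.

Variable z : T -> R.
Hypothesis zj : greedy_inv j z.

Definition flipped : {set T} := [set v | z v * s v < 0].

(** Once all pairs are fixed, [z] is [s] up to sign everywhere. When [s] is the sign vector of [U],
    this makes [z] the sign vector of [U] after flipping. *)
Lemma greedy_sign (v : T) : z v = sgn R flipped v * s v.
Proof.
have zc : z v = s v \/ z v = - s v.
  case: zj => h1 _ h3 _.
  case: (boolP [exists i, exists b, e i b == v]).
    case/existsP => i /existsP[[] /eqP <-];
      have [t [[->|->] t1 t2]] := h3 i (ltn_ord i);
      rewrite ?t1 ?t2; try (by left; ring); by right; ring.
  move=> /existsPn nv; left; apply: h1 => i b.
  by have /existsPn := nv i; apply.
have ssq : s v * s v = 1 by have [->|->] := s_cases v; ring.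
rewrite /sgn inE; case: zc => ->; rewrite ?mulNr ssq.
  by rewrite ltr10 mul1r.
by rewrite oppr_lt0 ltr01 ?mulN1r.
Qed.

Lemma greedy_card : #|flipped| = j.
Proof.
case: zj => h1 _ h3 _.
have ssq v : s v * s v = 1 by have [->|->] := s_cases v; ring.
(* [c] selects the flipped vertex of each pair: the [true] one exactly when its sign was
   reversed. *)
pose c i := e i (z (e i true) * s (e i true) < 0).
have c_inj : injective c by move=> i i' /e_inj[].
rewrite -[RHS]card_ord -(card_imset _ c_inj); apply: eq_card => v.
apply/idP/imsetP => [|[i _ ->]].
  rewrite inE => vz; case: (boolP [exists i, exists b, e i b == v]); last first.
    move=> /existsPn nv; move: vz; rewrite h1 ?ssq ?ltr10 // => i b.
    by have /existsPn := nv i; apply.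
  case/existsP => i /existsP[b /eqP eb]; exists i => //.
  have [t [tc t1 t2]] := h3 i (ltn_ord i).
  rewrite /c t2 -mulrA ssq mulr1; case: b eb => eb.
    by move: vz; rewrite -eb t2 -mulrA ssq mulr1 => ->.
  move: vz; rewrite -eb t1 mulNr -mulrA ssq mulr1 oppr_lt0 => t0.
  by rewrite ltNge ltW.
rewrite inE /c; have [t [tc t1 t2]] := h3 i (ltn_ord i).
rewrite t2 -mulrA ssq mulr1; case: tc => tE.
  by rewrite tE ltr10 t1 tE mul1r mulNr ssq oppr_lt0.
by rewrite tE oppr_lt0 ltr01 t2 tE mulN1r mulNr ssq oppr_lt0.
Qed.

End Greedy.

(** * The approximation ratio *)

(** Compared entry by entry: in the row of a vertex [e i false] both sides equal the weight, since
    the starting vector is 0 there; in any other row the left side is half of [w * (1 - s_u * s_v)],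
    which is at most both [w] and [w * (1 - s_u * s_v)]. *)
Lemma quad_unpaired_le (R : realType) (n : nat) (G : wgraph R n)
    (U : {set 'I_n}) (j : nat) (e : 'I_j -> bool -> 'I_n) :
  (forall i b i' b', e i b = e i' b' -> i = i' /\ b = b') ->
  2 * cut G U + 2^-1 * \sum_i gain G U (e i false) <=
  \sum_u \sum_v wt G u v - quad (wt G) (unpaired (sgn R U) e).
Proof.
move=> e_inj; pose x i := e i false.
have x_inj : injective x by move=> i i' /e_inj[].
have -> : \sum_i gain G U (e i false) = \sum_(v in x @: 'I_j) gain G U v.
  by rewrite big_imset /=; [apply: eq_bigl => i; rewrite inE|move=> i i' _ _ /x_inj].
have -> : 2 * cut G U = 2^-1 * (4 * cut G U) by field.
rewrite cut_sgn -mulrDr [X in _ * (_ + X)]big_mkcond /= -big_split /= /quad -sumrB mulr_sumr.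
apply: ler_sum => u _; rewrite -sumrB.
rewrite (_ : (if _ then _ else _) =
    \sum_v (u \in x @: 'I_j)%:R * (wt G u v * (1 + sgn R U u * sgn R U v))); last first.
  by case: ifP; rewrite -mulr_sumr ?mul1r ?mul0r.
rewrite -big_split /= mulr_sumr; apply: ler_sum => v _.
rewrite /unpaired; have w0 := wt_ge0 G u v.
case: (boolP (u \in x @: 'I_j)) => [/imsetP[i _ ui]|_].
  rewrite ifT; last by apply/existsP; exists i; apply/existsP; exists false; rewrite ui.
  by have [->|->] := sgn_cases R U u; have [->|->] := sgn_cases R U v; rewrite /=; nra.
by case: ifP => _; case: ifP => _;
  have [->|->] := sgn_cases R U u; have [->|->] := sgn_cases R U v; rewrite /=; nra.
Qed.

(* The two families of pairs consist of distinct edges, so that together they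
   lose at most what [U] cuts. *)
Lemma pair_weight_sum_ge (R : realType) (n : nat) (G : wgraph R n)
    (U : {set 'I_n}) (j : nat) (e0 e1 : 'I_j -> bool -> 'I_n) :
  (forall i, e0 i false = e1 i false) ->
  injective (fun i => e0 i false) ->
  (forall i, e0 i true != e1 i true) ->
  (forall i i', e0 i false != e0 i' true) ->
  (forall i i', e0 i false != e1 i' true) ->
  - cut G U <= \sum_i pair_weight (wt G) (sgn R U) e0 i +
               \sum_i pair_weight (wt G) (sgn R U) e1 i.
Proof.
move=> e01 x_inj ne ne0 ne1.
pose m (u v : 'I_n) : R := wt G u v * (1 - sgn R U u * sgn R U v).
have m_ge0 u v : 0 <= m u v.
  rewrite /m mulr_ge0 ?wt_ge0 //.
  by have [->|->] := sgn_cases R U u; have [->|->] := sgn_cases R U v; lra.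
have m_sym u v : m u v = m v u by rewrite /m wt_sym; ring.
pose L : {set 'I_n} := (fun i => e0 i false) @: 'I_j.
(* In the formula for [4 * cut G U] the pairs between [L] and its complement occur in both
   orientations, so one orientation accounts for at most half. *)
have LC : \sum_(u in L) \sum_(v in ~: L) m u v <= 2 * cut G U.
  have : \sum_(u in L) \sum_(v in ~: L) m u v + \sum_(u in ~: L) \sum_(v in L) m u v
         <= 4 * cut G U.
    rewrite cut_sgn [leRHS](bigID (mem L)) /=; apply: lerD.
      apply: ler_sum => u _; rewrite [leRHS](bigID (mem (~: L))) /= lerDl.
      by apply: sumr_ge0 => v _; apply: m_ge0.
    rewrite (eq_bigl (fun i => i \notin L)); last by move=> i; rewrite inE.
    apply: ler_sum => u _; rewrite [leRHS](bigID (mem L)) /= lerDl.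
    by apply: sumr_ge0 => v _; apply: m_ge0.
  rewrite [X in _ + X]exchange_big /=.
  rewrite [X in _ + X](_ : _ = \sum_(u in L) \sum_(v in ~: L) m u v); first lra.
  by apply: eq_bigr => u _; apply: eq_bigr => v _.
suff : - (\sum_(u in L) \sum_(v in ~: L) m u v) <=
    2 * (\sum_i pair_weight (wt G) (sgn R U) e0 i +
         \sum_i pair_weight (wt G) (sgn R U) e1 i) by lra.
rewrite /L big_imset /=; last by move=> i i' _ _ /x_inj.
rewrite (eq_bigl xpredT); last by move=> i; rewrite inE.
rewrite -big_split /= mulr_sumr -sumrN; apply: ler_sum => i _.
(* Both partners of a heavy vertex lie outside [L] and differ, so both terms are present in the
   inner sum; each satisfies [- m <= 2 * (w * (s_u * s_v))]. *)
have yL b : (if b then e1 i true else e0 i true) \in ~: L.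
  rewrite inE; apply/imsetP => -[i' _]; case: b => h.
    by have := ne1 i' i; rewrite -h eqxx.
  by have := ne0 i' i; rewrite -h eqxx.
rewrite (bigD1 (e0 i true)) /=; last exact: (yL false).
rewrite (bigD1 (e1 i true)) /=; last by rewrite (yL true) eq_sym ne.
have : 0 <= \sum_(v in ~: L | (v != e0 i true) && (v != e1 i true)) m (e0 i false) v.
  by apply: sumr_ge0 => v _; apply: m_ge0.
rewrite (eq_bigl (fun v => (v \in ~: L) && (v != e0 i true) && (v != e1 i true)));
  last by move=> v; rewrite andbA.
set rest := \sum_(v | _) _.
rewrite /pair_weight -e01 /m.
have := wt_ge0 G (e0 i false) (e0 i true).
have := wt_ge0 G (e0 i false) (e1 i true).
by have [->|->] := sgn_cases R U (e0 i false);
  have [->|->] := sgn_cases R U (e0 i true);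
  have [->|->] := sgn_cases R U (e1 i true); lra.
Qed.

Lemma greedy_approx (R : realType) (n : nat) (G : wgraph R n)
    (U C : {set 'I_n}) (j : nat) (e : 'I_j -> bool -> 'I_n) (z : 'I_n -> R) :
  (forall i b i' b', e i b = e i' b' -> i = i' /\ b = b') ->
  (forall i v, (forall i', e i' false != v) -> gain G U v <= gain G U (e i false)) ->
  - cut G U <= 2 * \sum_i pair_weight (wt G) (sgn R U) e i ->
  greedy_inv (wt G) (sgn R U) e j z -> #|C| = j ->
  cut G (symdiff U C) <= 4 * cut G (symdiff U (flipped (sgn R U) z)).
Proof.
move=> e_inj top pw zj Cj.
have lo := quad_unpaired_le G U e_inj.
have up := cut_symdiff_le G U C.
have [_ _ _ zq] := zj.
rewrite cut_quad (_ : sgn R _ = z); last first.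
  apply/funext => v; rewrite sgn_symdiff mulrC; symmetry.
  exact: (greedy_sign (sgn_cases R U) zj).
rewrite (eq_bigl xpredT) in zq; last by move=> i; rewrite ltn_ord.
have x_inj : injective (fun i => e i false) by move=> i i' /e_inj[].
have C_top : \sum_(v in C) gain G U v <= \sum_i gain G U (e i false).
  have -> : \sum_i gain G U (e i false) =
      \sum_(v in (fun i => e i false) @: 'I_j) gain G U v.
    by rewrite big_imset /=; [apply: eq_bigl => i; rewrite inE|move=> i i' _ _ /x_inj].
  apply: sum_top; first by rewrite card_imset // card_ord.
  move=> u v /imsetP[i _ ->] vL; apply: top => i'.
  by apply: contraNneq vL => <-; apply: imset_f.
(* Four times the new cut is at least [2 * cut G U] plus half the gains plus twice the pair weights,
   hence at least [cut G U] plus half the gains, which bounds the cut given by [C]. *)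
lra.
Qed.

(** * Ranking and pairing the vertices *)

Section Ranking.
Variables (R : realType) (n : nat) (f : 'I_n -> R).

(** Decreasing [f] with ties broken by index, phrased with the strict comparisons available to a
    program. *)
Definition precedes (u v : 'I_n) : bool :=
  (f v < f u) || (~~ (f u < f v) && (u < v)%N).

(** Positions are found by counting predecessors, which needs only a double loop and no sorting. *)
Definition rank (v : 'I_n) : nat := \sum_u precedes u v.

(** By transitivity the predecessors of [u] precede [v], and [u] itself is one more. *)
Lemma rank_mono (u v : 'I_n) : precedes u v -> (rank u < rank v)%N.
Proof.
move=> uv; rewrite /rank (bigD1 u) //= [X in (_ < X)%N](bigD1 u) //= uv.
rewrite {1}/precedes ltxx ltnn andbF /= add0n add1n ltnS; apply: leq_sum => x _.
have : precedes x u -> precedes x v; last first.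
  by case: precedes => [/(_ isT)->|_] //; case: precedes.
move: uv; rewrite /precedes.
case: (ltgtP (f u) (f v)); case: (ltgtP (f x) (f u)); case: (ltgtP (f x) (f v)) => //=;
  move=> *; try lia; lra.
Qed.

Lemma rank_lt (v : 'I_n) : (rank v < n)%N.
Proof.
have -> : n = (\sum_(u < n) 1)%N by rewrite sum1_card card_ord.
rewrite /rank (bigD1 v) //= [X in (_ < X)%N](bigD1 v) //=.
rewrite {1}/precedes ltxx ltnn andbF /= add0n add1n ltnS; apply: leq_sum => u _.
by case: precedes.
Qed.

Definition rank_ord (v : 'I_n) : 'I_n := Ordinal (rank_lt v).

Lemma rank_ord_inj : injective rank_ord.
Proof.
move=> u v /(congr1 val) /= ruv; apply/val_inj/eqP.
apply: contraT => uv; have : precedes u v || precedes v u.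
  by rewrite /precedes; case: (ltgtP (f u) (f v)) => //= _; rewrite -neq_ltn.
by case/orP => /rank_mono; lia.
Qed.

Definition ranked (i : 'I_n) : 'I_n := invF rank_ord_inj i.

Lemma rank_ranked i : rank (ranked i) = i.
Proof. by rewrite -[RHS](congr1 val (f_invF rank_ord_inj i)). Qed.

Lemma ranked_inj : injective ranked.
Proof. by move=> i i' h; apply/val_inj; rewrite /= -rank_ranked h rank_ranked. Qed.

Lemma ranked_noninc (i i' : 'I_n) : (i <= i')%N -> f (ranked i') <= f (ranked i).
Proof.
apply: contraTT; rewrite -ltNge -ltnNge => lt.
by rewrite -rank_ranked -(rank_ranked i) rank_mono // /precedes lt.
Qed.

Lemma ranked_rank (v : 'I_n) : ranked (rank_ord v) = v.
Proof. exact: invF_f. Qed.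

Variable j : nat.
Hypothesis jn : (j + j <= n)%N.

Lemma heavy_lt (i : 'I_j) : (i < n)%N.
Proof. by have := ltn_ord i; lia. Qed.

Lemma light_lt (b : bool) (i : 'I_j) : (j + (i + b) %% (n - j) < n)%N.
Proof.
have := ltn_ord i; have : (0 < n - j)%N by have := ltn_ord i; lia.
by move=> /(ltn_pmod (i + b)); lia.
Qed.

(* The [i]-th of the [j] heaviest vertices is paired with the [i]-th of the
   others or, if [b], with the next one, cyclically. *)
Definition pairing (b : bool) (i : 'I_j) (c : bool) : 'I_n :=
  ranked (if c then Ordinal (light_lt b i) else Ordinal (heavy_lt i)).

(** Heavy positions lie below [j] and light ones do not; a shift modulo [n - j] is injective on
    indices below [j] because [j <= n - j]. *)
Lemma pairing_inj b i c i' c' :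
  pairing b i c = pairing b i' c' -> i = i' /\ c = c'.
Proof.
have li := ltn_ord i; have li' := ltn_ord i'.
move=> /ranked_inj; case: c; case: c' => /(congr1 val) /= h; try lia; split=> //.
  apply/val_inj => /=; move: h => /addnI /eqP; rewrite eqn_modDr !modn_small; lia.
by apply/val_inj.
Qed.

Lemma pairing_top b i v :
  (forall i', pairing b i' false != v) -> f v <= f (pairing b i false).
Proof.
move=> nv; rewrite -[v](invF_f rank_ord_inj) -/(ranked _); apply: ranked_noninc => /=.
rewrite leqNgt; apply/negP => lt.
have lj : (rank v < j)%N by have := ltn_ord i; lia.
have /eqP := nv (Ordinal lj); apply.
rewrite /pairing -[RHS](ranked_rank v); congr ranked; exact: val_inj.
Qed.

Lemma pairing_neq i i' b b' : pairing b i false != pairing b' i' true.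
Proof.
by apply/eqP => /ranked_inj /(congr1 val) /=; have := ltn_ord i; lia.
Qed.

Lemma pairing_shift i : (1 < n - j)%N -> pairing false i true != pairing true i true.
Proof.
move=> nj; apply/eqP => /ranked_inj /(congr1 val) /= /addnI /eqP.
by rewrite addn0 -{1}(addn0 i) eqn_modDl mod0n modn_small.
Qed.

End Ranking.

(* When [n = 2] and [j = 1] both pairings coincide, but then all sets of size
   [j] are equal up to complementation. *)
Lemma selected_pairing_approx (R : realType) (n : nat) (G : wgraph R n)
    (U C : {set 'I_n}) (j : nat) (jn : (j + j <= n)%N) (b : bool) (z : 'I_n -> R) :
  let pw b := \sum_i pair_weight (wt G) (sgn R U) (pairing (gain G U) jn b) i in
  b = (pw false - pw true < 0) ->
  greedy_inv (wt G) (sgn R U) (pairing (gain G U) jn b) j z -> #|C| = j ->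
  cut G (symdiff U C) <= 4 * cut G (symdiff U (flipped (sgn R U) z)).
Proof.
move=> pw bE zj Cj; set e := pairing _ _ in pw bE zj.
have e_inj i c i' c' : e b i c = e b i' c' -> i = i' /\ c = c'.
  exact: pairing_inj.
have [nj|nj] := ltnP 1 (n - j).
  apply: (greedy_approx e_inj _ _ zj) => //.
  - by move=> i v; apply: pairing_top.
  (* [b] selects the pairing of larger total weight, so twice its weight is at least the sum of
     both. *)
  apply: (@le_trans _ _ (pw false + pw true)).
    apply: pair_weight_sum_ge => //; try by move=> *; apply: pairing_neq.
      by move=> i i'; rewrite /e => /pairing_inj[].
    by move=> i; apply: pairing_shift.
  by move: bE; rewrite -/(pw b); case: ltP => h -> ; lra.
have Fj : #|flipped (sgn R U) z| = j.
  exact: (greedy_card (sgn_cases R U) e_inj zj).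
move: Fj; set F := flipped _ z => Fj.
have F0 := cut_ge0 G (symdiff U F).
(* Now [j <= n - j <= 1]: either both sets are empty, or they are singletons among two vertices.
   Complementing does not change the cut. *)
suff : C = F \/ C = ~: F.
  by case=> ->; rewrite ?symdiff_setC ?cut_setC; lra.
have [j0|j1] : j = 0%N \/ j = 1%N by lia.
  by left; rewrite (cards0_eq (etrans Cj j0)) (cards0_eq (etrans Fj j0)).
have n2 : n = 2%N by lia.
have [CF|/subsetPn[v vC vF]] := boolP (C \subset F).
  by left; apply/eqP; rewrite eqEcard CF Cj Fj leqnn.
right; apply/eqP; rewrite eqEcard cardsCs finset.setCK card_ord Fj Cj.
rewrite (_ : (n - j <= j)%N) ?andbT; last lia.
apply/fintype.subsetP => u uC; rewrite inE.
have /cards1P[c Cc] : #|C| == 1%N by rewrite Cj j1.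
by move: uC vC vF; rewrite Cc !inE => /eqP-> /eqP->.
Qed.

(** * The program *)

(* Integer variables: 0 is [n], 1 is [k], 2 is [j = min(k, n - k)], 3 selects
   the pairing, 4 and 5 are loop counters, 6 and 7 are temporary. Memory: the
   ranked vertices are in the integer cells [2n, ..., 3n-1], the gains in the
   real cells [n^2, ..., n^2+n-1], and the signs [z] in the [n] cells after. *)
Definition wtE (a b : iexp) : rexp := RLoad (IAdd (IMul a (IVar 0)) b).
Definition sgnE (a : iexp) : rexp :=
  RSub (RInt (INat 1)) (RMul (RInt (INat 2)) (RInt (ILoad a))).
Definition gain_cell (a : iexp) : iexp := IAdd (IMul (IVar 0) (IVar 0)) a.
Definition sign_cell (a : iexp) : iexp :=
  IAdd (IAdd (IMul (IVar 0) (IVar 0)) (IVar 0)) a.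
Definition rank_cell (a : iexp) : iexp := IAdd (IAdd (IVar 0) (IVar 0)) a.
Definition out_cell (a : iexp) : iexp := IAdd (IVar 0) a.
Definition heavyE : iexp := ILoad (rank_cell (IVar 4)).
(** The remainder of [t] modulo [m] is obtained from the Euclidean quotient. *)
Definition lightE (b : iexp) : iexp :=
  let m := ISub (IVar 0) (IVar 2) in let t := IAdd (IVar 4) b in
  ILoad (rank_cell (IAdd (IVar 2) (ISub t (IMul (IDiv t m) m)))).
Definition pair_weightE (b : iexp) : rexp :=
  RMul (wtE heavyE (lightE b)) (RMul (sgnE heavyE) (sgnE (lightE b))).
Definition rzero : rexp := RInt (INat 0).
(** Resets the real accumulator; it also serves as an idle branch wherever the accumulator is not
    live. *)
Definition skip : prog := PRSet 0 rzero.
Definition add_to_sum (e : rexp) : prog := PRSet 0 (RAdd (RVar 0) e).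

Definition half_prog : prog :=
  PIf (ILt (ISub (IVar 0) (IVar 1)) (IVar 1))
    (PISet 2 (ISub (IVar 0) (IVar 1))) (PISet 2 (IVar 1)).

Definition gain_prog : prog :=
  PFor 4 (PSeq skip (PSeq
    (PFor 5 (add_to_sum (RMul (wtE (IVar 4) (IVar 5))
       (RAdd (RInt (INat 1)) (RMul (sgnE (IVar 4)) (sgnE (IVar 5)))))))
    (PRStore (gain_cell (IVar 4)) (RVar 0)))).

Definition rank_prog : prog :=
  let gu := RLoad (gain_cell (IVar 5)) in
  let gv := RLoad (gain_cell (IVar 4)) in
  let count := PISet 6 (incr_var 6) in
  PFor 4 (PSeq (PISet 6 (INat 0)) (PSeq
    (PFor 5 (PIf (RLt gv gu) count
       (PIf (RLt gu gv) skip (PIf (ILt (IVar 5) (IVar 4)) count skip))))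
    (PIStore (rank_cell (IVar 6)) (IVar 4)))).

(** Loops always run to [n], so iterations from [j] on must idle. Here they add zero, because [skip]
    would erase the running sum. *)
Definition select_prog : prog :=
  PSeq skip (PSeq
    (PFor 4 (PIf (ILt (IVar 4) (IVar 2))
       (add_to_sum (RSub (pair_weightE (INat 0)) (pair_weightE (INat 1))))
       (add_to_sum rzero)))
    (PIf (RLt (RVar 0) rzero) (PISet 3 (INat 1)) (PISet 3 (INat 0)))).

Definition init_prog : prog :=
  PSeq (PFor 4 (PRStore (sign_cell (IVar 4)) (sgnE (IVar 4))))
    (PFor 4 (PIf (ILt (IVar 4) (IVar 2))
       (PSeq (PRStore (sign_cell heavyE) rzero)
             (PRStore (sign_cell (lightE (IVar 3))) rzero))
       skip)).

Definition greedy_prog : prog :=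
  let x := IVar 6 in let y := IVar 7 in
  PFor 4 (PIf (ILt (IVar 4) (IVar 2))
    (PSeq (PISet 6 heavyE) (PSeq (PISet 7 (lightE (IVar 3))) (PSeq skip (PSeq
       (PFor 5 (add_to_sum (RMul (RLoad (sign_cell (IVar 5)))
          (RSub (RMul (wtE y (IVar 5)) (sgnE y)) (RMul (wtE x (IVar 5)) (sgnE x))))))
       (PIf (RLt (RVar 0) rzero)
          (PSeq (PRStore (sign_cell x) (RSub rzero (sgnE x)))
                (PRStore (sign_cell y) (sgnE y)))
          (PSeq (PRStore (sign_cell x) (sgnE x))
                (PRStore (sign_cell y) (RSub rzero (sgnE y)))))))))
    skip).

(* The flipped set if [j = k], its complement if [j < k]. *)
Definition output_prog : prog :=
  let d := ISub (IVar 1) (IVar 2) in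
  PFor 4 (PIf (RLt (RMul (RLoad (sign_cell (IVar 4))) (sgnE (IVar 4))) rzero)
    (PIStore (out_cell (IVar 4)) (ISub (INat 1) d))
    (PIStore (out_cell (IVar 4)) d)).

Definition maxcut_prog : prog :=
  PSeq half_prog (PSeq gain_prog (PSeq rank_prog (PSeq select_prog
    (PSeq init_prog (PSeq greedy_prog output_prog))))).

Lemma maxcut_prog_depth : (depth maxcut_prog <= 2)%N.
Proof. by []. Qed.

Lemma maxcut_prog_wf (R : realType) : well_formed R maxcut_prog.
Proof.
rewrite /=; repeat split=> //; move=> s M M1 [sv sm] /=;
  first [exact: leqW (sm _) | exact: leqW (sv _) |
    by rewrite (leq_trans (leq_subr _ _)) // (leq_trans _ (leqnSn M)) // (leq_trans (sv _)) |
    have := sv 6%N; lia].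
Qed.

(** * Correctness of the program *)

Lemma big_ord_ltS (V : Type) (idx : V) (op : Monoid.com_law idx) (n i : nat)
    (F : 'I_n -> V) (lt_in : (i < n)%N) :
  \big[op/idx]_(u < n | (u < i.+1)%N) F u =
  op (\big[op/idx]_(u < n | (u < i)%N) F u) (F (Ordinal lt_in)).
Proof.
rewrite (bigD1 (Ordinal lt_in)) //= Monoid.mulmC; congr (op _ _); apply: eq_bigl => u.
by rewrite -(inj_eq val_inj) /= ltnS [(u <= i)%N]leq_eqVlt; case: ltngtP.
Qed.

Lemma run_seq (R : realType) (p q : prog) (s : state R) :
  run (PSeq p q) s = run q (run p s).
Proof. by []. Qed.

Lemma run_if (R : realType) (b : bexp) (p q : prog) (s : state R) :
  run (PIf b p q) s = if beval s b then run p s else run q s.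
Proof. by []. Qed.

Lemma ivar_set_neq (R : realType) (s : state R) (x y m : nat) :
  y != x -> ivar (set_ivar s x m) y = ivar s y.
Proof. by rewrite /= /upd => /negbTE->. Qed.

Definition fset_at (T : eqType) (V : Type) (f : T -> V) (x : T) (r : V) (y : T) : V :=
  if y == x then r else f y.

Section Correctness.
Variables (R : realType) (n : nat) (G : wgraph R n) (U : {set 'I_n}) (k : nat).
Hypothesis kn : (k <= n)%N.
Let s_ := sgn R U.

(** Abstraction relation between machine states and the objects of the argument. Loop counters,
    temporaries, the accumulator and the output cells are left free; [g], [P] and [z] are arbitrary
    until the program fills them. *)
Record layout (s : state R) (j b : nat) (g : 'I_n -> R) (P : 'I_n -> nat)
    (z : 'I_n -> R) : Prop := Layout {
  layout_n : ivar s 0 = n;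
  layout_k : ivar s 1 = k;
  layout_j : ivar s 2 = j;
  layout_b : ivar s 3 = b;
  layout_U : forall v : 'I_n, imem s v = (v \in U);
  layout_P : forall v : 'I_n, imem s (n + n + v) = P v;
  layout_w : forall u v : 'I_n, rmem s (u * n + v) = wt G u v;
  layout_g : forall v : 'I_n, rmem s (n * n + v) = g v;
  layout_z : forall v : 'I_n, rmem s (n * n + n + v) = z v
}.

Lemma wt_cell_lt (u v : 'I_n) : (u * n + v < n * n)%N.
Proof. by have := ltn_ord u; have := ltn_ord v; nia. Qed.

Section LayoutTheory.
Variables (s : state R) (j b : nat) (g : 'I_n -> R) (P : 'I_n -> nat) (z : 'I_n -> R).
Hypothesis ly : layout s j b g P z.

Lemma layout_set_ivar x m : (3 < x)%N -> layout (set_ivar s x m) j b g P z.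
Proof.
by case: ly => *; split=> //=; rewrite /upd ltn_eqF // ?(ltn_trans _ x3) //; lia.
Qed.

Lemma layout_set_select m : layout (set_ivar s 3 m) j m g P z.
Proof. by case: ly => *; split. Qed.

Lemma layout_set_rvar x r : layout (set_rvar s x r) j b g P z.
Proof. by case: ly. Qed.

Lemma layout_set_gain (v : 'I_n) a r : a = (n * n + v)%N ->
  layout (set_rmem s a r) j b (fset_at g v r) P z.
Proof.
move=> ->; case: ly => ? ? ? ? ? ? hw hg hz; split=> //= [u x|x|x]; rewrite /upd.
- by rewrite ltn_eqF // ltn_addr ?wt_cell_lt.
- by rewrite eqn_add2l /fset_at -(inj_eq val_inj) /= hg.
- by rewrite -addnA eqn_add2l gtn_eqF ?hz ?addnA // ltn_addr.
Qed.

Lemma layout_set_sign (v : 'I_n) a r : a = (n * n + n + v)%N ->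
  layout (set_rmem s a r) j b g P (fset_at z v r).
Proof.
move=> ->; case: ly => ? ? ? ? ? ? hw hg hz; split=> //= [u x|x|x]; rewrite /upd.
- by rewrite ltn_eqF // -addnA ltn_addr ?wt_cell_lt.
- by rewrite -addnA eqn_add2l ltn_eqF ?hg // ltn_addr.
- by rewrite eqn_add2l /fset_at -(inj_eq val_inj) /= hz.
Qed.

Lemma layout_set_rank (v : 'I_n) a m : a = (n + n + v)%N ->
  layout (set_imem s a m) j b g (fset_at P v m) z.
Proof.
move=> ->; case: ly => ? ? ? ? hU hP ? ? ?; split=> //= x; rewrite /upd.
- by rewrite ltn_eqF // -addnA ltn_addr.
- by rewrite eqn_add2l /fset_at -(inj_eq val_inj) /= hP.
Qed.

Lemma layout_set_out (v : 'I_n) a m : a = (n + v)%N ->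
  layout (set_imem s a m) j b g P z.
Proof.
move=> ->; case: ly => ? ? ? ? hU hP ? ? ?; split=> //= x; rewrite /upd.
- by rewrite ltn_eqF // ltn_addr.
- by rewrite -addnA eqn_add2l gtn_eqF ?addnA // ltn_addr.
Qed.

Lemma eval_wt a a' (u v : 'I_n) : ieval s a = u -> ieval s a' = v ->
  reval s (wtE a a') = wt G u v.
Proof. by move=> /= -> ->; rewrite (layout_n ly) (layout_w ly). Qed.

Lemma eval_sgn a (u : 'I_n) : ieval s a = u -> reval s (sgnE a) = s_ u.
Proof. by move=> /= ->; rewrite (layout_U ly) /s_ /sgn; case: (u \in U) => /=; ring. Qed.

Lemma eval_gain a (u : 'I_n) : ieval s a = u -> reval s (RLoad (gain_cell a)) = g u.
Proof. by move=> /= ->; rewrite (layout_n ly) (layout_g ly). Qed.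

Lemma eval_sign_cell a (u : 'I_n) : ieval s a = u ->
  ieval s (sign_cell a) = (n * n + n + u)%N.
Proof. by move=> /= ->; rewrite (layout_n ly). Qed.

Lemma eval_sign a (u : 'I_n) : ieval s a = u -> reval s (RLoad (sign_cell a)) = z u.
Proof. by move=> /= ->; rewrite (layout_n ly) (layout_z ly). Qed.

End LayoutTheory.

(** Rule for accumulation loops: [I] is any property insensitive to the accumulator and to the
    counter 5, and it fixes the value of each summand. *)
Lemma sum_loop (e : rexp) (F : 'I_n -> R) (I : state R -> Prop) (s : state R) :
  (forall s1 r, I s1 -> I (set_rvar s1 0 r)) ->
  (forall s1 m, I s1 -> I (set_ivar s1 5 m)) ->
  (forall s1 (u : 'I_n), I s1 -> ivar s1 5 = u -> reval s1 e = F u) ->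
  ivar s 0 = n -> I s -> rvar s 0 = 0 ->
  I (run (PFor 5 (add_to_sum e)) s) /\
  rvar (run (PFor 5 (add_to_sum e)) s) 0 = \sum_u F u.
Proof.
move=> Ir Ii Ie sn Is s0.
pose J m s1 := I s1 /\ rvar s1 0 = \sum_(u < n | (u < m)%N) F u.
suff [h1 h2] : J n (run (PFor 5 (add_to_sum e)) s).
  by split=> //; rewrite h2; apply: eq_bigl => u; rewrite ltn_ord.
apply: for_ind => //; first by split; [exact: Ii|rewrite big1].
move=> i s1 lt_in s1i s1n [i1 i2]; split; first by apply/Ii/Ir.
by rewrite (big_ord_ltS _ _ lt_in) /= /upd /= i2 (Ie _ (Ordinal lt_in)).
Qed.

Lemma half_progP (s : state R) j b g P z : layout s j b g P z ->
  layout (run half_prog s) (minn k (n - k)) b g P z.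
Proof.
case=> sn sk *; rewrite /= sn sk; case: ltnP => h.
  by split=> //=; rewrite /upd /= sn sk (minn_idPr (ltnW h)).
by split=> //=; rewrite /upd /= sk (minn_idPl h).
Qed.

Lemma gain_progP (s : state R) j b g P z : layout s j b g P z ->
  layout (run gain_prog s) j b (gain G U) P z.
Proof.
move=> ly.
pose I m s1 := exists2 g', layout s1 j b g' P z &
  forall v : 'I_n, (v < m)%N -> g' v = gain G U v.
suff [g' ly' gE] : I n (run gain_prog s).
  by have <- : g' = gain G U by apply/funext => v; rewrite gE.
apply: for_ind => //; first exact: layout_n ly.
  by exists g => //; apply: layout_set_ivar.
move=> i s1 lt_in s1i s1n [g' ly' gE]; pose v := Ordinal lt_in.
rewrite !run_seq; set s2 := run (PFor 5 _) (run skip s1).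
have [[ly2 s2i] s2r] : (layout s2 j b g' P z /\ ivar s2 4 = v) /\ rvar s2 0 = gain G U v.
  apply: (@sum_loop _ _ (fun s2 => layout s2 j b g' P z /\ ivar s2 4 = v)) => //.
  - by move=> s2' r [h1 h2]; split=> //; apply: layout_set_rvar.
  - by move=> s2' r [h1 h2]; split=> //; apply: layout_set_ivar.
  - move=> s2' u [h1 h2] h3.
    have {}h2 : ieval s2' (IVar 4) = v := h2.
    have {}h3 : ieval s2' (IVar 5) = u := h3.
    rewrite [LHS](_ : _ = reval s2' (wtE (IVar 4) (IVar 5)) *
      (1 + reval s2' (sgnE (IVar 4)) * reval s2' (sgnE (IVar 5)))) //.
    by rewrite (eval_wt h1 h2 h3) (eval_sgn h1 h2) (eval_sgn h1 h3).
  - by split=> //; apply: layout_set_rvar.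
exists (fset_at g' v (gain G U v)).
  apply: layout_set_ivar => //; rewrite -s2r.
  by apply: layout_set_gain => //; rewrite /= -/s2 (layout_n ly2) s2i.
move=> u; rewrite ltnS leq_eqVlt /fset_at => /orP[/eqP ui|ui].
  by rewrite (_ : u = v) ?eqxx //; apply/val_inj.
by case: eqP => [->|] //; rewrite gE.
Qed.

(** Invariant: each processed vertex is stored at the position given by its rank. As ranks form a
    bijection, the full table is the inverse [ranked]. *)
Lemma rank_progP (s : state R) j b g P z : layout s j b g P z ->
  layout (run rank_prog s) j b g (fun i => ranked g i) z.
Proof.
move=> ly.
pose I m s1 := exists2 P', layout s1 j b g P' z &
  forall v : 'I_n, (v < m)%N -> P' (rank_ord g v) = v.
suff [P' ly' PE] : I n (run rank_prog s).
  rewrite -(_ : P' = fun i => ranked g i) //; apply/funext => i.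
  rewrite -[in LHS](f_invF (@rank_ord_inj _ _ g) i); exact: PE.
apply: for_ind => //; first exact: layout_n ly.
  by exists P => //; apply: layout_set_ivar.
move=> i s1 lt_in s1i s1n [P' ly' PE]; pose v := Ordinal lt_in.
rewrite !run_seq; set s2 := run (PFor 5 _) _.
pose J m s2' := [/\ layout s2' j b g P' z, ivar s2' 4 = v &
  ivar s2' 6 = (\sum_(u < n | (u < m)%N) precedes g u v)%N].
have [ly2 s2v s2r] : J n s2.
  apply: for_ind => //.
    split=> //; last by rewrite /= /upd /= big1.
    by apply: layout_set_ivar => //; apply: layout_set_ivar.
  move=> i' s2' lt_in' h5 h0 [h1 h4 h6]; pose u := Ordinal lt_in'.
  have e4 : ieval s2' (IVar 4) = v := h4.
  have e5 : ieval s2' (IVar 5) = u := h5.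
  have E : ivar (run (PIf (RLt (RLoad (gain_cell (IVar 4))) (RLoad (gain_cell (IVar 5))))
       (PISet 6 (incr_var 6))
       (PIf (RLt (RLoad (gain_cell (IVar 5))) (RLoad (gain_cell (IVar 4)))) skip
         (PIf (ILt (IVar 5) (IVar 4)) (PISet 6 (incr_var 6)) skip))) s2') 6 =
       (ivar s2' 6 + precedes g u v)%N.
    rewrite [run _ _]/= -/(reval s2' (RLoad (gain_cell (IVar 4)))).
    rewrite -/(reval s2' (RLoad (gain_cell (IVar 5)))).
    rewrite (eval_gain h1 e4) (eval_gain h1 e5) /precedes h4 h5.
    case: (g v < g u); first by rewrite /= /upd /= addn1.
    case: (g u < g v); first by rewrite /= addn0.
    by case: ltnP => _; rewrite /= /upd /= ?addn1 ?addn0.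
  split.
  - apply: layout_set_ivar => //.
    rewrite /=; case: ifP => _; first exact: layout_set_ivar.
    case: ifP => _; first exact: layout_set_rvar.
    by case: ifP => _; [exact: layout_set_ivar|exact: layout_set_rvar].
  - by rewrite ivar_set_neq // ivar_run.
  - by rewrite ivar_set_neq // E h6 (big_ord_ltS _ _ lt_in').
have {}s2r : ivar s2 6 = rank_ord g v.
  by rewrite s2r /= /rank; apply: eq_bigl => u; rewrite ltn_ord.
exists (fset_at P' (rank_ord g v) i).
  apply: layout_set_ivar => //; rewrite -[i in fset_at _ _ i]s2v.
  by apply: layout_set_rank => //; rewrite /= (layout_n ly2) s2r.
move=> u; rewrite ltnS leq_eqVlt /fset_at => /orP[/eqP ui|ui].
  by rewrite (_ : u = v) ?eqxx //; apply/val_inj.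
by case: eqP => [/rank_ord_inj->|_] //; rewrite PE.
Qed.

(** With [d = k - j], the values written are [1 - d] and [d]. If [d = 0] they are 1 and 0; otherwise
    truncation gives 0 and a non-zero number, which complements the set. *)
Lemma output_progP (s : state R) j b g P z : layout s j b g P z -> (j <= k)%N ->
  output n (run output_prog s) =
  if j == k then flipped s_ z else ~: flipped s_ z.
Proof.
move=> ly jk.
pose I m s1 := layout s1 j b g P z /\ forall v : 'I_n, (v < m)%N ->
  imem s1 (n + v) = (if v \in flipped s_ z then 1 - (k - j) else k - j)%N.
have [_ sE] : I n (run output_prog s).
  apply: for_ind => //; first exact: layout_n ly.
    by split=> //; apply: layout_set_ivar.
  move=> i s1 lt_in s1i s1n [h1 hE]; pose v := Ordinal lt_in.
  have h4 : ieval s1 (IVar 4) = v := s1i.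
  set p := PIf _ _ _.
  have -> : run p s1 = set_imem s1 (n + v)
      (if v \in flipped s_ z then 1 - (k - j) else k - j)%N.
    rewrite run_if (_ : beval s1 _ = (v \in flipped s_ z)).
      by case: ifP => _; rewrite /= s1n s1i (layout_k h1) (layout_j h1).
    by rewrite inE -(eval_sign h1 h4) -(eval_sgn h1 h4).
  split.
    by apply: layout_set_ivar => //; apply: (layout_set_out h1 (v := v)).
  move=> u; rewrite ltnS leq_eqVlt /= /upd eqn_add2l => /orP[/eqP ui|ui].
    by rewrite ui eqxx (_ : u = v) //; apply/val_inj.
  by rewrite ltn_eqF // hE.
apply/setP => v; rewrite inE sE //.
case: (eqVneq j k) => [<-|ne]; first by rewrite subnn; case: (v \in flipped s_ z).
have /eqP kj : (1 - (k - j) == 0)%N by lia.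
by rewrite kj [in RHS]inE; case: (v \in flipped s_ z) => //=; lia.
Qed.

Section Pairs.
Variables (j : nat) (jn : (j + j <= n)%N).
Let g := gain G U.
Let e := pairing g jn.

Lemma eval_heavy s b z (i : 'I_j) : layout s j b g (fun i => ranked g i) z ->
  ivar s 4 = i -> ieval s heavyE = e false i false.
Proof.
move=> ly /= ->; rewrite (layout_n ly).
exact: (layout_P ly (Ordinal (heavy_lt jn i))).
Qed.

Lemma eval_light s b z (i : 'I_j) (c : bool) be :
  layout s j b g (fun i => ranked g i) z ->
  ivar s 4 = i -> ieval s be = c -> ieval s (lightE be) = e c i true.
Proof.
move=> ly /= -> ->; rewrite (layout_n ly) (layout_j ly).
have -> : ((i + c) - (i + c) %/ (n - j) * (n - j) = (i + c) %% (n - j))%N.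
  by rewrite {1}(divn_eq (i + c) (n - j)) addKn.
exact: (layout_P ly (Ordinal (light_lt jn c i))).
Qed.

Let pw b := \sum_i pair_weight (wt G) s_ (e b) i.

Lemma select_progP s b z : layout s j b g (fun i => ranked g i) z ->
  layout (run select_prog s) j (pw false - pw true < 0)%R g (fun i => ranked g i) z.
Proof.
move=> ly; rewrite !run_seq; set s2 := run (PFor 4 _) _.
pose F i := pair_weight (wt G) s_ (e false) i - pair_weight (wt G) s_ (e true) i.
pose I m s1 := layout s1 j b g (fun i => ranked g i) z /\
  rvar s1 0 = \sum_(i < j | (i < m)%N) F i.
have [ly2 s2r] : I n s2.
  apply: for_ind => //; first exact: layout_n ly.
    split; last by rewrite big1.
    by apply: layout_set_ivar => //; apply: layout_set_rvar.
  move=> i s1 lt_in s1i s1n [h1 h2].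
  have [lt_ij|le_ji] := ltnP i j; last first.
    rewrite /= (layout_j h1) s1i ltnNge le_ji /=; split.
      by apply: layout_set_ivar => //; apply: layout_set_rvar.
    rewrite /= /upd /= h2 addr0; apply: eq_bigl => i'.
    by have := ltn_ord i'; lia.
  have -> : run (PIf (ILt (IVar 4) (IVar 2))
       (add_to_sum (RSub (pair_weightE (INat 0)) (pair_weightE (INat 1))))
       (add_to_sum rzero)) s1 =
       run (add_to_sum (RSub (pair_weightE (INat 0)) (pair_weightE (INat 1)))) s1.
    by rewrite run_if /beval /ieval (layout_j h1) s1i lt_ij.
  split; first by apply: layout_set_ivar => //; apply: layout_set_rvar.
  rewrite (big_ord_ltS _ _ lt_ij) -h2 [LHS](_ : _ = rvar s1 0 +
    (reval s1 (pair_weightE (INat 0)) - reval s1 (pair_weightE (INat 1)))) //.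
  congr (_ + _); set i' := Ordinal lt_ij.
  have pE (c : bool) : reval s1 (pair_weightE (INat c)) =
      pair_weight (wt G) s_ (e c) i'.
    have hx := eval_heavy h1 (s1i : ivar s1 4 = i').
    have hy := eval_light h1 (s1i : ivar s1 4 = i') (erefl : ieval s1 (INat c) = c).
    rewrite [LHS](_ : _ = reval s1 (wtE heavyE (lightE (INat c))) *
      (reval s1 (sgnE heavyE) * reval s1 (sgnE (lightE (INat c))))) //.
    by rewrite (eval_wt h1 hx hy) (eval_sgn h1 hx) (eval_sgn h1 hy).
  by rewrite /F -(pE false) -(pE true).
have {}s2r : rvar s2 0 = pw false - pw true.
  by rewrite s2r /F /pw -sumrB; apply: eq_bigl => i; rewrite (heavy_lt jn).
rewrite /= s2r ?mulr0n; case: (_ < 0)%R; exact: (layout_set_select ly2).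
Qed.

Lemma init_progP s (b : bool) z : layout s j b g (fun i => ranked g i) z ->
  layout (run init_prog s) j b g (fun i => ranked g i) (unpaired s_ (e b)).
Proof.
move=> ly; rewrite run_seq.
set s1 := run (PFor 4 _) s.
have {}ly : layout s1 j b g (fun i => ranked g i) s_.
  pose I m s2 := exists2 z', layout s2 j b g (fun i => ranked g i) z' &
    forall v : 'I_n, (v < m)%N -> z' v = s_ v.
  suff [z' ly' zE] : I n s1.
    by have <- : z' = s_ by apply/funext => v; rewrite zE.
  apply: for_ind => //; first exact: layout_n ly.
    by exists z => //; apply: layout_set_ivar.
  move=> i s2 lt_in s2i s2n [z' ly' zE]; pose v := Ordinal lt_in.
  have h4 : ieval s2 (IVar 4) = v := s2i.
  exists (fset_at z' v (s_ v)).
    apply: layout_set_ivar => //; rewrite -(eval_sgn ly' h4).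
    apply: layout_set_sign => //; by rewrite /= s2n s2i.
  move=> u; rewrite ltnS leq_eqVlt /fset_at => /orP[/eqP ui|ui].
    by rewrite (_ : u = v) ?eqxx //; apply/val_inj.
  by case: eqP => [->|] //; rewrite zE.
pose I m s2 := exists z', [/\ layout s2 j b g (fun i => ranked g i) z',
  forall (i : 'I_j) c, (i < m)%N -> z' (e b i c) = 0 &
  forall v, (forall i c, e b i c != v) -> z' v = s_ v].
suff [z' [ly' z0 z1]] : I n (run (PFor 4 (PIf (ILt (IVar 4) (IVar 2))
       (PSeq (PRStore (sign_cell heavyE) rzero)
             (PRStore (sign_cell (lightE (IVar 3))) rzero))
       skip)) s1).
  have <- : z' = unpaired s_ (e b).
    apply/funext => v; rewrite /unpaired.
    case: ifPn => [/existsP[i /existsP[c /eqP<-]]|/existsPn nv].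
      by rewrite z0 //; have := ltn_ord i; lia.
    by apply: z1 => i c; have /existsPn := nv i; apply.
  by [].
apply: for_ind => //; first exact: layout_n ly.
  by exists s_; split=> //; apply: layout_set_ivar.
move=> i s2 lt_in s2i s2n [z' [h1 z0 z1]].
have [lt_ij|le_ji] := ltnP i j; last first.
  exists z'; split=> //.
    apply: layout_set_ivar => //.
    by rewrite /= (layout_j h1) s2i ltnNge le_ji; apply: layout_set_rvar.
  by move=> i' c _; apply: z0; have := ltn_ord i'; lia.
pose i' := Ordinal lt_ij.
have hx := eval_heavy h1 (s2i : ivar s2 4 = i').
set s3 := run (PRStore (sign_cell heavyE) rzero) s2.
have h3 : layout s3 j b g (fun i => ranked g i) (fset_at z' (e b i' false) 0).
  by apply: layout_set_sign => //; apply: (eval_sign_cell h1 hx).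
have hy := eval_light h3 (s2i : ivar s3 4 = i') (layout_b h3 : ieval s3 (IVar 3) = b).
exists (fset_at (fset_at z' (e b i' false) 0) (e b i' true) 0); split.
- apply: layout_set_ivar => //.
  rewrite (_ : run _ s2 = run (PRStore (sign_cell (lightE (IVar 3))) rzero) s3);
    last by rewrite run_if /beval /ieval (layout_j h1) s2i lt_ij run_seq.
  by apply: layout_set_sign => //; apply: (eval_sign_cell h3 hy).
- move=> i2 c i2i; rewrite /fset_at; case: eqP => // n1; case: eqP => // n2.
  apply: z0; move: i2i; rewrite ltnS leq_eqVlt => /orP[/eqP i2i|//].
  have E : i2 = i' by apply/val_inj.
  by case: n1; case: c n2 => // []; rewrite E.
- move=> v nv; rewrite /fset_at eq_sym (negbTE (nv _ _)) eq_sym (negbTE (nv _ _)).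
  exact: z1.
Qed.

Lemma fset_at_flip_pair (b : bool) (i : 'I_j) (z : 'I_n -> R) (t r1 r2 : R) :
  r1 = - (t * s_ (e b i false)) -> r2 = t * s_ (e b i true) ->
  fset_at (fset_at z (e b i false) r1) (e b i true) r2 = flip_pair s_ (e b) i t z.
Proof.
move=> -> ->; apply/funext => v; rewrite /fset_at /flip_pair.
case: (eqVneq v (e b i true)) => [->|_]; last by case: eqVneq => [->|].
by rewrite eq_sym (negbTE (pairing_neq _ _ _ _ _ _)).
Qed.

Lemma greedy_progP s (b : bool) :
  layout s j b g (fun i => ranked g i) (unpaired s_ (e b)) ->
  exists2 z, layout (run greedy_prog s) j b g (fun i => ranked g i) z &
    greedy_inv (wt G) s_ (e b) j z.
Proof.
move=> ly.
(* The count of fixed pairs is [minn m j], since iterations from [j] on do nothing. *)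
pose I m s1 := exists2 z, layout s1 j b g (fun i => ranked g i) z &
    greedy_inv (wt G) s_ (e b) (minn m j) z.
suff [z h1 h2] : I n (run greedy_prog s).
  by exists z => //; move: h2; rewrite (minn_idPr _) //; lia.
apply: for_ind => //; first exact: layout_n ly.
  exists (unpaired s_ (e b)); first exact: layout_set_ivar.
  by rewrite min0n; apply: greedy_init.
move=> i s1 lt_in s1i s1n [z h1 zi].
rewrite run_if /beval /ieval (layout_j h1) s1i.
have [lt_ij|le_ji] := ltnP i j; last first.
  exists z; first by apply: layout_set_ivar => //; apply: layout_set_rvar.
  by move: zi; rewrite !(minn_idPr _) //; lia.
move: zi; rewrite !(minn_idPl _) //; last exact: ltnW.
pose i' := Ordinal lt_ij; set x := e b i' false; set y := e b i' true => zi.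
have {}zi : greedy_inv (wt G) s_ (e b) i' z := zi.
have hx := eval_heavy h1 (s1i : ivar s1 4 = i').
rewrite !run_seq; set s2 := run (PISet 6 heavyE) s1.
have h2 : layout s2 j b g (fun i => ranked g i) z by apply: layout_set_ivar.
have hy := eval_light h2 (s1i : ivar s2 4 = i') (layout_b h2 : ieval s2 (IVar 3) = b).
set s3 := run (PISet 7 _) s2.
have h3 : layout s3 j b g (fun i => ranked g i) z by apply: layout_set_ivar.
set s5 := run (PFor 5 _) _.
have [[h5 s5x s5y] s5r] : [/\ layout s5 j b g (fun i => ranked g i) z,
    ieval s5 (IVar 6) = x & ieval s5 (IVar 7) = y] /\
    rvar s5 0 = pull (wt G) s_ (e b) i' z.
  apply: (@sum_loop _ _ (fun s5 => [/\ layout s5 j b g (fun i => ranked g i) z,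
    ieval s5 (IVar 6) = x & ieval s5 (IVar 7) = y])) => //.
  - by move=> s' r [a1 a2 a3]; split=> //; apply: layout_set_rvar.
  - by move=> s' r [a1 a2 a3]; split=> //; apply: layout_set_ivar.
  - move=> s' u [a1 a2 a3] a4; have {}a4 : ieval s' (IVar 5) = u := a4.
    rewrite [LHS](_ : _ = reval s' (RLoad (sign_cell (IVar 5))) *
      (reval s' (wtE (IVar 7) (IVar 5)) * reval s' (sgnE (IVar 7)) -
       reval s' (wtE (IVar 6) (IVar 5)) * reval s' (sgnE (IVar 6)))) //.
    rewrite (eval_sign a1 a4) (eval_wt a1 a3 a4) (eval_wt a1 a2 a4).
    by rewrite (eval_sgn a1 a3) (eval_sgn a1 a2).
  - by split; [exact: (layout_set_rvar h3)|exact: hx|exact: hy].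
have e_inj i1 c1 i2 c2 : e b i1 c1 = e b i2 c2 -> i1 = i2 /\ c1 = c2.
  exact: pairing_inj.
pose store r1 r2 := PSeq (PRStore (sign_cell (IVar 6)) r1) (PRStore (sign_cell (IVar 7)) r2).
(* The second value is evaluated after the first store, hence the quantification over the stored
   [r]. *)
have storeP r1 r2 t : reval s5 r1 = - (t * s_ x) ->
    (forall r, reval (set_rmem s5 (ieval s5 (sign_cell (IVar 6))) r) r2 = t * s_ y) ->
    layout (run (store r1 r2) s5) j b g (fun i => ranked g i) (flip_pair s_ (e b) i' t z).
  move=> hr1 hr2; rewrite run_seq; set s6 := run _ s5.
  have h6 : layout s6 j b g (fun i => ranked g i) (fset_at z x (- (t * s_ x))).
    by rewrite -hr1; apply: layout_set_sign => //; apply: (eval_sign_cell h5 s5x).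
  rewrite -(@fset_at_flip_pair b i' z t _ _ erefl erefl) -/x -/y -(hr2 (reval s5 r1)).
  apply: layout_set_sign => //; exact: (eval_sign_cell h6 (s5y : ieval s6 (IVar 7) = y)).
have hsx := eval_sgn h5 s5x.
have hsy r : reval (set_rmem s5 (ieval s5 (sign_cell (IVar 6))) r) (sgnE (IVar 7)) = s_ y.
  exact: (eval_sgn h5 s5y).
(* A negative pull leads to [t = 1] and any other to [t = -1], so [t * pull] is never positive. *)
rewrite run_if [beval _ _]/= s5r mulr0n; case: ltP => hp.
  exists (flip_pair s_ (e b) i' 1 z).
    apply: layout_set_ivar => //; apply: storeP.
      by rewrite [LHS](_ : _ = 0 - reval s5 (sgnE (IVar 6))) // hsx mul1r sub0r.
    by move=> r; rewrite hsy mul1r.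
  rewrite (minn_idPl lt_ij); apply: (greedy_step (wt_sym G) (wt_diag G) e_inj zi); first by left.
  by rewrite mul1r ltW.
exists (flip_pair s_ (e b) i' (-1) z).
  apply: layout_set_ivar => //; apply: storeP.
    by rewrite hsx mulN1r opprK.
  move=> r; set s6 := set_rmem _ _ _.
  by rewrite [LHS](_ : _ = 0 - reval s6 (sgnE (IVar 7))) // hsy mulN1r sub0r.
rewrite (minn_idPl lt_ij); apply: (greedy_step (wt_sym G) (wt_diag G) e_inj zi); first by right.
by rewrite mulN1r oppr_le0.
Qed.

End Pairs.

Lemma input_layout : exists g P z, layout (input G U k) 0 0 g P z.
Proof.
exists (fun v : 'I_n => rmem (input G U k) (n * n + v)%N).
exists (fun v : 'I_n => imem (input G U k) (n + n + v)%N).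
exists (fun v : 'I_n => rmem (input G U k) (n * n + n + v)%N); split=> //.
- by move=> v /=; rewrite valK.
- move=> u v /=; rewrite (bigD1 u) //= [X in _ + X]big1 ?addr0.
    rewrite big_mkcond (bigD1 v) //= eqxx big1 ?addr0 => [|i /negbTE ne].
      by rewrite /wt; case: ifP.
    by rewrite eqn_add2l -[(_ == _ :> nat)]/(v == i) eq_sym ne.
  move=> i ne; rewrite big1 // => i' /andP[/eqP E _].
  case/eqP: ne; apply/val_inj => /=; have := ltn_ord v; have := ltn_ord i'; nia.
Qed.

Lemma input_ibounded : ibounded (input G U k) (n + 2).
Proof.
split=> [[|[|x]]|x] /=; rewrite ?nth_nil; try lia.
by case: insub => [i|]; [case: (i \in U)|]; lia.
Qed.

Lemma maxcut_prog_correct :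
  let C := output n (run maxcut_prog (input G U k)) in
  #|C| = k /\ 4^-1 * maxcutkR G U k <= cut G (symdiff U C).
Proof.
have [g [P [z0 ly]]] := input_layout.
set j := minn k (n - k); have jn : (j + j <= n)%N by rewrite /j; lia.
move/half_progP/gain_progP/rank_progP/(select_progP jn): ly.
set b := (_ < _)%R => /(init_progP jn)/greedy_progP[z ly zj].
have jk : (j <= k)%N by rewrite /j; lia.
move=> C; have CE := output_progP ly jk; rewrite -/C in CE.
have Fj : #|flipped s_ z| = j.
  exact: (greedy_card (sgn_cases R U) (@pairing_inj _ _ _ _ jn b) zj).
have Fopt (C' : {set 'I_n}) : #|C'| = j -> cut G (symdiff U C') <= 4 * cut G (symdiff U (flipped s_ z)).
  exact: (selected_pairing_approx (erefl b) zj).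
have cutC : cut G (symdiff U C) = cut G (symdiff U (flipped s_ z)).
  by rewrite CE; case: eqP => // _; rewrite symdiff_setC cut_setC.
have cardC : #|C| = k.
  rewrite CE; case: eqP => [<- //|ne]; rewrite cardsCs finset.setCK card_ord Fj.
  by move: ne; rewrite /j; lia.
split=> //; rewrite ler_pdivrMl // cutC; apply: bigmax_le.
  by rewrite mulr_ge0 ?cut_ge0.
move=> C' /eqP C'k; case: (eqVneq j k) => [e|ne]; first by apply: Fopt; rewrite e.
(* Here [j = n - k], so the complement of a competitor of size [k] has size [j] and gives the same
   cut. *)
rewrite -cut_setC -symdiff_setC; apply: Fopt.
by rewrite cardsCs finset.setCK card_ord C'k; move: ne; rewrite /j; lia.
Qed.
End Correctness.

Theorem theorem4 (R : realType) (a b : R) (ha : 0 < a) (hb : 0 < b) :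
  exists rho : R, 0 < rho /\
  forall c : nat,
  exists (A : cmd) (T : nat -> nat),
    soft_bigO T (fun n : nat => (n%:R : R) `^ (7 / 2)) /\
    forall (n : nat) (G : wgraph R n) (U : {set 'I_n}) (k : nat),
      (k <= n)%N ->
      halts_within A (input G U k) (T n) /\
      (a * n%:R <= #|U|%:R -> b * n%:R <= k%:R ->
       1 - 1 / n%:R ^+ c <=
         prob_halt A (input G U k) (T n)
           (fun s : state R =>
              let C := output n s in
              #|C| = k /\
              rho * maxcutkR G U k <= cut G (symdiff U C))).
Proof.
exists 4^-1; split=> [|c]; first by rewrite invr_gt0.
have [T [Tbound TP]] := soft_bigO_depth2 (maxcut_prog_wf R) maxcut_prog_depth.
exists (compile maxcut_prog), T; split=> // n G U k kn.
have ex := TP (input G U k) n erefl (input_ibounded G U kn).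
split=> [w|_ _].
  by have [t [ext tT]] := ex w; exists (run maxcut_prog (input G U k)), w, t.
(* The run is deterministic and succeeds with probability one, so the same program works for every
   [c]. *)
rewrite (prob_halt_eq1 (s' := run maxcut_prog (input G U k))).
- by rewrite lerBlDr lerDl divr_ge0 ?exprn_ge0.
- by move=> w; have [t [ext _]] := ex w; exists t.
- exact: maxcut_prog_correct.
Qed.
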